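(* Let $p\in[2,\infty[$ and let $(\mathbb B,|\cdot|_{\mathbb B})$ be a separable Banach space belonging to the class $\widetilde{\mathcal C}_2(p,\tilde c_p)$. Let $(X_i)_{i\ge1}$ be a sequence of centered random variables with values in $\mathbb B$ such that $\mathbb E|X_i|_{\mathbb B}^p<\infty$ for all $i$. Let $(\mathcal F_i)_{i\ge0}$ be an increasing sequence of $\sigma$-algebras such that $X_i$ is $\mathcal F_i$-measurable for each $i$, and write $\mathbb E_i(\cdot)=\mathbb E(\cdot\mid\mathcal F_i)$. Let $S_n=\sum_{i=1}^nX_i$ and $$b_{i,n}=\max_{i\le \ell\le n}\Big(\mathbb E_0\Big(|X_i|_{\mathbb B}^{p/2}\Big|\sum_{k=i}^{\ell}\mathbb E_i(X_k)\Big|_{\mathbb B}^{p/2}\Big)\Big)^{2/p}.$$ Then for every integer $n\ge0$, almost surely, $$\mathbb E_0(|S_n|_{\mathbb B}^p)\le K^p\Big(\sum_{i=1}^n b_{i,n}\Big)^{p/2},\qquad K=\sqrt{2p^{-1}}\sqrt{\max(\tilde c_p,p/2)}.$$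
   Context: For a separable Banach space $(\mathbb B,|\cdot|_{\mathbb B})$ and $p\in[2,\infty[$, let $\psi_p(x)=|x|_{\mathbb B}^p$. $\mathbb B$ belongs to the class $\widetilde{\mathcal C}_2(p,\tilde c_p)$ if $\psi_p$ is twice differentiable and its second derivative satisfies $|D^2\psi_p(x)(u,v)|\le \tilde c_p|x|_{\mathbb B}^{p-2}|u|_{\mathbb B}|v|_{\mathbb B}$ for all $x,u,v\in\mathbb B$ (here $D^2\psi_p(x)(u,v)$ is the second derivative of $\psi_p$ at $x$ in directions $u,v$). *)

(* Defs.v *)
From HB Require Import structures.
From mathcomp Require Import all_boot all_order all_algebra.
From mathcomp Require Import all_classical all_reals all_analysis.
Set Implicit Arguments. Unset Strict Implicit. Unset Printing Implicit Defensive.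
Import Order.TTheory GRing.Theory Num.Theory.
Import numFieldNormedType.Exports.
Local Open Scope classical_set_scope.
Local Open Scope ring_scope.

Definition separable_space (B : topologicalType) : Prop :=
  exists D : set B, countable D /\ closure D = setT.

(** Twice (Fréchet) differentiability of [psi : B -> R], with second
    derivative [D2 x u v] (= D^2 psi(x)(u,v), [u] = direction of the
    second differentiation, [v] = argument of the first differential).
    Spelled out since the library has no normed space of bounded operators:
    - psi is differentiable everywhere (library differential ['d psi x]);
    - D2 x is a bounded bilinear form;
    - x |-> 'd psi x is Fréchet differentiable in operator norm with
      derivative h |-> D2 x h. *)
Definition twice_diff_with {R : realType} {B : normedModType R}
  (psi : B -> R) (D2 : B -> B -> B -> R) : Prop :=
  (forall x, differentiable psi x) /\
  forall x : B,
    [/\ (forall (a : R) (u1 u2 v : B),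
           D2 x (a *: u1 + u2) v = a * D2 x u1 v + D2 x u2 v),
        (forall (a : R) (u v1 v2 : B),
           D2 x u (a *: v1 + v2) = a * D2 x u v1 + D2 x u v2),
        (exists M : R, forall u v, `|D2 x u v| <= M * `|u| * `|v|) &
        (forall e : R, 0 < e -> exists2 d : R, 0 < d &
           forall h : B, `|h| < d -> forall v : B,
             `|('d psi (x + h) : B -> R) v - ('d psi x : B -> R) v - D2 x h v|
               <= e * `|h| * `|v|)].

Definition psi_p {R : realType} {B : normedModType R} (p : R) (x : B) : R :=
  `|x| `^ p.

Definition class_C2tilde {R : realType} (B : normedModType R) (p c : R) : Prop :=
  exists D2 : B -> B -> B -> R,
    twice_diff_with (psi_p p) D2 /\
    forall x u v : B, `|D2 x u v| <= c * `|x| `^ (p - 2) * `|u| * `|v|.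

Definition G_measurable {T : Type} {S : topologicalType}
  (G : set (set T)) (f : T -> S) : Prop :=
  forall O : set S, open O -> G (f @^-1` O).

Definition cont_lin_functional {R : realType} {B : normedModType R}
  (f : B -> R) : Prop :=
  (forall (a : R) (u v : B), f (a *: u + v) = a * f u + f v) /\ continuous f.

Section CondExp.
Context {d : measure_display} {T : measurableType d} {R : realType}.
Variable P : probability T R.

Definition filtration (F : nat -> set (set T)) : Prop :=
  forall i, [/\ sigma_algebra setT (F i), F i `<=` measurable &
                F i `<=` F i.+1].

Definition is_cond_exp (G : set (set T)) (X Y : T -> R) : Prop :=
  [/\ P.-integrable setT (EFin \o X),
      G_measurable G Y,
      P.-integrable setT (EFin \o Y) &
      forall A, G A -> (\int[P]_(x in A) (Y x)%:E = \int[P]_(x in A) (X x)%:E)%E].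

(** [Y] is a version of the (Bochner) conditional expectation E(X | G) of a
    Bochner integrable B-valued [X] (B separable): [Y] is G-Borel-measurable,
    Bochner integrable, and integrates like [X] against every continuous
    linear functional on every set of G. *)
Definition is_cond_expB {B : normedModType R} (G : set (set T))
  (X Y : T -> B) : Prop :=
  [/\ G_measurable measurable X,
      P.-integrable setT (fun x => (`|X x|)%:E),
      G_measurable G Y,
      P.-integrable setT (fun x => (`|Y x|)%:E) &
      forall f : B -> R, cont_lin_functional f -> forall A, G A ->
        (\int[P]_(x in A) (f (Y x))%:E = \int[P]_(x in A) (f (X x))%:E)%E].

(** Centered (Bochner mean zero), for Bochner integrable X. *)
Definition centeredB {B : normedModType R} (X : T -> B) : Prop :=
  forall f : B -> R, cont_lin_functional f ->
    (\int[P]_x (f (X x))%:E = 0)%E.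

End CondExp.

(* Main.v *)
Require Import Defs.
From HB Require Import structures.
From mathcomp Require Import all_boot all_order all_algebra.
From mathcomp Require Import all_classical all_reals all_analysis.
From mathcomp Require Import measurable_realfun lra ring.
Set Implicit Arguments. Unset Strict Implicit. Unset Printing Implicit Defensive.
Import Order.TTheory GRing.Theory Num.Theory.
Import numFieldNormedType.Exports.
Local Open Scope classical_set_scope.
Local Open Scope ring_scope.

(** Write psi = |.|^p, L_k(s) = Dpsi(S_k + s X_{k+1}) - Dpsi(S_k).  Convexity of
    psi and a summation by parts bound psi(S_m + t X_{m+1}) by the sum over
    k < m of L_k(1) evaluated at the increments from k + 1 on, plus
    L_m(t)(t X_{m+1}).  As L_k(s) is measurable at time k + 1, these increments
    may be replaced in expectation by their conditional expectations given
    F_{k+1}.  The derivative in s of the resulting integral is an integral of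
    D^2 psi, hence by Hoelder at most
    C (E|S_k + s X_{k+1}|^p)^(1 - 2/p) b_{k+1}; by induction the terms k < m
    integrate to a telescoping sum, and the term k = m gives a differential
    inequality for E|S_m + t X_{m+1}|^p of Bihari type.

    All this takes place in expectation over a fixed event A of F_0 with
    deterministic b_i.  The almost sure statement follows because the event
    where it fails is a countable union of events of F_0 on which the Z i l are
    bounded by rationals for which W is still too large; the bound in
    expectation makes each of them negligible. *)

(** * Calculus for the p-th power of the norm *)

(** Young's inequality with exponents [p / (p - 2)] and [p / 2], after normalising [a] by [H^(1/p)]
    and [y] by [b]. If [a^p] integrates to at most [H] and [y^(p/2)] to at most [b^(p/2)], the
    bracket integrates to at most 1, which is Hoelder's bound. *)
Lemma scaled_young {R : realType} (p H b a y : R) :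
  2 <= p -> 0 < H -> 0 < b -> 0 <= a -> 0 <= y ->
  a `^ (p - 2) * y <= H `^ (1 - 2 / p) * b *
    ((1 - 2 / p) * (a `^ p / H) + 2 / p * (y `^ (p / 2) / b `^ (p / 2))).
Proof.
move=> p2 H0 b0 a0 y0; have p0 : 0 < p by lra.
(* At [p = 2] the exponent [p / (p - 2)] degenerates; both sides then equal [y]. *)
have [->|pN2] := eqVneq p 2.
  rewrite divff// !subrr !powRr0 !mul0r add0r !mul1r !powRr1 ?(ltW b0)//.
  by rewrite (mulrC b) divfK// gt_eqF// b0.
have {pN2}p2' : 2 < p by rewrite lt_neqAle eq_sym pN2.
have Hp0 : 0 < H `^ p^-1 by rewrite powR_gt0.
pose a1 := (a / H `^ p^-1) `^ (p - 2).
have y1 : 0 <= y / b by rewrite divr_ge0// ltW.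
have q1 : 0 < p / (p - 2) by rewrite divr_gt0// subr_gt0.
have q2 : 0 < p / 2 by rewrite divr_gt0.
have q12 : (p / (p - 2))^-1 + (p / 2)^-1 = 1.
  by field; apply/andP; split; lra.
have := conjugate_powR (powR_ge0 _ _ : 0 <= a1) y1 q1 q2 q12.
have -> : a1 `^ (p / (p - 2)) = a `^ p / H.
  rewrite /a1 -powRrM (_ : (p - 2) * (p / (p - 2)) = p); last by field; lra.
  rewrite powRM ?invr_ge0 ?(ltW Hp0)// -powR_inv1 ?(ltW Hp0)// -!powRrM.
  rewrite (_ : p^-1 * (-1 * p) = -1); last by field; lra.
  by rewrite powR_inv1 ?(ltW H0).
have -> : (y / b) `^ (p / 2) = y `^ (p / 2) / b `^ (p / 2).
  rewrite powRM ?invr_ge0 ?(ltW b0)// -(powR_inv1 (ltW b0)) -powRrM.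
  by rewrite mulN1r powRN.
rewrite (_ : _ / (p / (p - 2)) = (1 - 2 / p) * (a `^ p / H)); last first.
  by field; apply/andP; split; lra.
rewrite (_ : _ / (p / 2) = 2 / p * (y `^ (p / 2) / b `^ (p / 2))); last first.
  by field; rewrite ?gt_eqF ?powR_gt0.
move=> le1; rewrite -ler_pdivrMl ?mulr_gt0 ?powR_gt0//.
apply: le_trans le1; rewrite le_eqVlt; apply/orP; left; apply/eqP.
rewrite /a1 powRM ?invr_ge0 ?(ltW Hp0)// -(powR_inv1 (ltW Hp0)) -!powRrM.
rewrite (_ : p^-1 * (-1 * (p - 2)) = - (1 - 2 / p)); last by field; lra.
by rewrite powRN invfM; ring.
Qed.

Lemma le_increment_derive {R : realType} (f g df dg : R -> R) (a b : R) :
  a <= b ->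
  (forall x, x \in `[a, b]%R -> is_derive x 1 f (df x)) ->
  (forall x, x \in `[a, b]%R -> is_derive x 1 g (dg x)) ->
  (forall x, x \in `]a, b[%R -> df x <= dg x) ->
  f b - f a <= g b - g a.
Proof.
move=> ab fdf gdg dfg; move: (ab); rewrite le_eqVlt => /predU1P[->|altb].
  by rewrite !subrr.
have ooW x : x \in `]a, b[%R -> x \in `[a, b]%R by rewrite !in_itv/= => /andP[/ltW-> /ltW->].
have drv x : x \in `]a, b[%R -> is_derive x 1 (g \- f) ((dg \- df) x).
  by move=> /ooW xab; apply: is_deriveB; [exact: gdg|exact: fdf].
have cont : {within `[a, b], continuous (g \- f)}.
  apply: derivable_within_continuous => x xab.
  by apply: derivableB; [have [] := gdg _ xab|have [] := fdf _ xab].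
have [c cab /= E] := MVT altb drv cont.
rewrite -subr_ge0.
have -> : g b - g a - (f b - f a) = (dg c - df c) * (b - a).
  by rewrite -E; ring.
by rewrite mulr_ge0 ?subr_ge0 ?dfg.
Qed.

(* [dpsi p x v] is D psi_p(x)(v).  Unlike with ['d (psi_p p) x], whose type
   depends on [x], one can rewrite in the point [x]. *)
Definition dpsi {R : realType} {B : normedModType R} (p : R) (x v : B) : R :=
  'd (psi_p p) x v.

Section smooth_norm.
Context {R : realType} {B : normedModType R} {p C : R} (D2 : B -> B -> B -> R).
Hypotheses (p2 : 2 <= p) (C0 : 0 <= C).
Hypothesis psi_D2 : twice_diff_with (@psi_p R B p) D2.
Hypothesis D2_le : forall x u v : B,
  `|D2 x u v| <= C * `|x| `^ (p - 2) * `|u| * `|v|.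
Local Notation psi := (@psi_p R B p).
Local Notation D := (@dpsi R B p).

Let p0 : 0 < p. Proof. exact: lt_le_trans p2. Qed.

Let p1 : 1 <= p. Proof. by apply: le_trans p2; rewrite ler1n. Qed.


Lemma diff_psi_is_derive (x u v : B) (s : R) :
  is_derive s 1 (fun s => D (x + s *: u) v) (D2 (x + s *: u) u v).
Proof.
have [_ /(_ (x + s *: u))[Dl _ _ Dd]] := psi_D2.
have D20 v' : D2 (x + s *: u) 0 v' = 0.
  by have := Dl 1 0 0 v'; rewrite scaler0 addr0 mul1r => /eqP;
     rewrite addrC -subr_eq subrr => /eqP.
have D2Z a u' v' : D2 (x + s *: u) (a *: u') v' = a * D2 (x + s *: u) u' v'.
  by have := Dl a u' 0 v'; rewrite addr0 D20 addr0.
suff H : h^-1 *: (D (x + (h *: 1 + s) *: u) v - D (x + s *: u) v)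
    @[h --> 0^'] --> D2 (x + s *: u) u v.
  by apply: DeriveDef; [apply/cvg_ex; eexists; exact: H|exact: cvg_lim].
apply/cvgrPdist_le => e e0.
have M0 : 0 < (`|u| + 1) * (`|v| + 1) by rewrite mulr_gt0// ltr_wpDl.
(* The remainder is at most this tolerance times [|h| |u| |v|]; adding 1 to the norms avoids a
   division by zero when [u] or [v] vanishes. *)
have [d d0 dP] := Dd (e / ((`|u| + 1) * (`|v| + 1))) (divr_gt0 e0 M0).
have du0 : 0 < d / (`|u| + 1) by rewrite divr_gt0// ltr_wpDl.
near=> h.
have h0 : h != 0 by near: h; exact: nbhs_dnbhs_neq.
have hd : `|h *: u| < d.
  rewrite normrZ.
  have : `|h| < d / (`|u| + 1) by near: h; apply: dnbhs0_lt.
  rewrite ltr_pdivlMr ?ltr_wpDl//; apply: le_lt_trans.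
  by rewrite ler_wpM2l// lerDl.
have := dP _ hd v; rewrite -/(D _ v) -/(D _ v).
have -> : x + s *: u + h *: u = x + (h *: 1 + s) *: u.
  by rewrite [h%:A]mulr1 scalerDl [h *: u + _]addrC addrA.
rewrite D2Z => le1.
have -> : D2 (x + s *: u) u v -
    h^-1 *: (D (x + (h *: 1 + s) *: u) v - D (x + s *: u) v) =
  - (h^-1 * (D (x + (h *: 1 + s) *: u) v - D (x + s *: u) v
       - h * D2 (x + s *: u) u v)).
  by rewrite [h^-1 *: _]/(h^-1 * _) mulrBr mulKf// opprB.
rewrite normrN normrM normfV mulrC ler_pdivrMr ?normr_gt0//.
apply: (le_trans le1); rewrite normrZ.
set M := (_ * _) in M0 le1 *.
have uv : `|u| * `|v| <= M by rewrite ler_pM// lerDl.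
have -> : e / M * (`|h| * `|u|) * `|v| = (e * `|h|) * ((`|u| * `|v|) / M) by ring.
by rewrite ler_piMr ?mulr_ge0 ?(ltW e0)// ler_pdivrMr// mul1r.
Unshelve. all: end_near. Qed.

Lemma norm_segment_le (x u : B) (s : R) : 0 <= s <= 1 ->
  `|x + s *: u| <= `|x| + `|u|.
Proof.
move=> /andP[s0 s1]; rewrite (le_trans (ler_normD _ _))// lerD2l normrZ.
by rewrite ger0_norm// ler_piMl.
Qed.

(** Mean value theorem along the segment from [x] to [x + u], on which [norm_segment_le] controls
    the weight in [D2_le]. *)
Lemma diff_psi_lip (x u v : B) :
  `|D (x + u) v - D x v| <= C * (`|x| + `|u|) `^ (p - 2) * `|u| * `|v|.
Proof.
have drv (s : R) : s \in `]0, 1[%R ->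
    is_derive s 1 (fun s : R => D (x + s *: u) v) (D2 (x + s *: u) u v).
  by move=> _; exact: diff_psi_is_derive.
have cont : {within `[(0:R), 1], continuous (fun s : R => D (x + s *: u) v)}.
  apply: derivable_within_continuous => s _.
  by have [] := diff_psi_is_derive x u v s.
have [s s01] := MVT ltr01 drv cont.
rewrite scale1r scale0r addr0 subr0 mulr1 => ->.
rewrite (le_trans (D2_le _ _ _))// ler_wpM2r// ler_wpM2r// ler_wpM2l//.
apply: ge0_ler_powR; rewrite ?nnegrE ?subr_ge0 ?addr_ge0//.
by apply: norm_segment_le; move: s01; rewrite in_itv/= => /andP[/ltW-> /ltW->].
Qed.

Lemma diff_psi_linear (x : B) (a : R) (u v : B) :
  D x (a *: u + v) = a * D x u + D x v.
Proof. by rewrite /dpsi linearP. Qed.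

Lemma diff_psiD (x u v : B) : D x (u + v) = D x u + D x v.
Proof. by rewrite /dpsi linearD. Qed.

Lemma diff_psiB (x u v : B) : D x (u - v) = D x u - D x v.
Proof. by rewrite /dpsi linearB. Qed.

Lemma diff_psiZ (x : B) (a : R) (u : B) : D x (a *: u) = a * D x u.
Proof. by rewrite /dpsi linearZ. Qed.

Lemma diff_psi_functional (x : B) : cont_lin_functional (D x).
Proof.
split; first exact: diff_psi_linear.
by have [/(_ x) dx _] := psi_D2; exact: diff_continuous.
Qed.

(** The norm is convex by the triangle inequality, and the power [p] is nondecreasing and convex on
    nonnegative reals. *)
Lemma psi_convex (x w : B) (t : R) : 0 <= t <= 1 ->
  psi (x + t *: w) <= (1 - t) * psi x + t * psi (x + w).
Proof.
move=> t01; have /andP[t0 t1] := t01; rewrite /psi_p.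
have cvx : ((1 - t) * `|x| + t * `|x + w|) `^ p <=
    (1 - t) * `|x| `^ p + t * `|x + w| `^ p.
  have := @convex_powR R p p1 (Itv01 t0 t1) `|x + w| `|x|.
  rewrite !inE/= !in_itv/= !andbT !normr_ge0 => /(_ isT isT).
  move=> H; rewrite [leRHS]addrC; apply: le_trans H; rewrite le_eqVlt.
  by apply/orP; left; apply/eqP; rewrite addrC.
apply: le_trans cvx; apply: ge0_ler_powR; rewrite ?nnegrE//.
- exact: ltW.
- by rewrite addr_ge0// mulr_ge0// subr_ge0.
have -> : x + t *: w = (1 - t) *: x + t *: (x + w).
  by rewrite scalerDr addrA -scalerDl subrK scale1r.
by rewrite (le_trans (ler_normD _ _))// !normrZ !ger0_norm// subr_ge0.
Qed.

(** By convexity the difference quotient at any step in ]0, 1] is at most the right-hand side, and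
    the differential is its limit from the right. *)
Lemma diff_psi_le (x w : B) : D x w <= psi (x + w) - psi x.
Proof.
have [/(_ x) dx _] := psi_D2.
have der : h^-1 *: (psi (h *: w + x) - psi x) @[h --> 0^'] --> D x w.
  by rewrite /dpsi -deriveE//; exact: diff_derivable.
have der' : h^-1 *: (psi (h *: w + x) - psi x) @[h --> 0^'+] --> D x w.
  exact: cvg_dnbhs_at_right.
rewrite -(cvg_lim _ der')//; apply: limr_le; first exact: cvgP der'.
near=> h.
have h0 : 0 < h by near: h; exact: nbhs_right_gt.
have h1 : h <= 1 by near: h; exact: nbhs_right_le.
rewrite [leLHS]mulrC ler_pdivrMr//.
have := @psi_convex x w h; rewrite (ltW h0) h1 => /(_ isT).
by rewrite (addrC x (h *: w)); lra.
Unshelve. all: end_near. Qed.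

Lemma psi_sub_le (x u : B) : psi x - psi (x - u) <= D x u.
Proof.
have := diff_psi_le x (- u); rewrite -scaleN1r diff_psiZ scaleN1r; lra.
Qed.

(** The increment [psi (x + u) - psi x] lies between the two sides. *)
Lemma diff_psi_mono (x u : B) : D x u <= D (x + u) u.
Proof.
apply: (le_trans (diff_psi_le x u)).
by have := psi_sub_le (x + u) u; rewrite addrK.
Qed.

(** For [t <= 1], [psi (t *: w)] is at most [t^2 psi w], whereas a positive [D 0 w] would force
    linear growth by the gradient inequality. *)
Lemma diff_psi0 (v : B) : D 0 v = 0.
Proof.
suff H w : D 0 w <= 0.
  by apply/eqP; rewrite eq_le H -oppr_le0 -mulN1r -diff_psiZ H.
rewrite leNgt; apply/negP => Dw0.
have psi0 : psi 0 = 0 by rewrite /psi_p normr0 powR0 ?gt_eqF.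
have w0 : 0 < psi w by have := diff_psi_le 0 w; rewrite add0r psi0 subr0; lra.
(* Small enough that [D 0 w <= t * psi w] yields the contradiction [D 0 w <= D 0 w / 2]. *)
pose t := Num.min 1 (D 0 w / psi w / 2).
have t0 : 0 < t by rewrite lt_min ltr01 !divr_gt0.
have t1 : t <= 1 by rewrite ge_min lexx.
have := diff_psi_le 0 (t *: w); rewrite add0r psi0 subr0 diff_psiZ.
rewrite /psi_p normrZ gtr0_norm// powRM ?(ltW t0)// => le1.
have : t `^ p <= t * t.
  rewrite -expr2 -powR_mulrn ?(ltW t0)//.
  by apply: ger_powR; rewrite ?t0.
move=> le2.
have : t * D 0 w <= t * t * psi w.
  by apply: (le_trans le1); rewrite ler_wpM2r// ltW.
rewrite -mulrA ler_pM2l// => le3.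
have : t <= D 0 w / psi w / 2 by rewrite ge_min lexx orbT.
rewrite ler_pdivlMr// ler_pdivlMr//; lra.
Qed.

Lemma diff_psi_growth (x v : B) :
  `|D x v| <= C * `|x| `^ (p - 2) * `|x| * `|v|.
Proof. by have := diff_psi_lip 0 x v; rewrite add0r diff_psi0 subr0 normr0 add0r. Qed.

(** Once [D x z.2] is split off, the remaining difference tends to 0 by the Lipschitz bound, which
    is uniform in the base point for [|z.1 - x| <= 1]. *)
Lemma diff_psi_continuous : continuous (fun z : B * B => D z.1 z.2).
Proof.
move=> [x v].
have -> : (fun z : B * B => D z.1 z.2) =
    (fun z : B * B => (D z.1 z.2 - D x z.2) + D x z.2).
  by apply/funext => z; rewrite subrK.
have c1 : z.1 @[z --> (x, v)] --> x by exact: cvg_fst.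
have c2 : z.2 @[z --> (x, v)] --> v by exact: cvg_snd.
suff H : D z.1 z.2 - D x z.2 @[z --> (x, v)] --> D x v - D x v.
  apply: cvgD; first exact: H.
  have [_ cD] := diff_psi_functional x.
  exact: (cvg_comp _ _ c2 (cD v)).
rewrite subrr.
apply: norm_cvg0.
apply: (@squeeze_cvgr _ _ _ _ (fun=> 0)
  (fun z : B * B => C * (`|x| + 1) `^ (p - 2) * `|z.1 - x| * `|z.2|)).
- near=> z; rewrite normr_ge0/=.
  have z1 : `|z.1 - x| <= 1.
    by near: z; apply: cvgr_distC_le.
  rewrite -{1}(subrKC x z.1) (le_trans (diff_psi_lip _ _ _))//.
  rewrite ler_wpM2r// ler_wpM2r// ler_wpM2l//.
  by apply: ge0_ler_powR; rewrite ?nnegrE ?subr_ge0 ?addr_ge0// lerD2l.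
- exact: cvg_cst.
have -> : 0 = C * (`|x| + 1) `^ (p - 2) * `|x - x| * `|v| :> R.
  by rewrite subrr normr0 mulr0 mul0r.
apply: cvgM; last exact: cvg_norm.
apply: cvgM; first exact: cvg_cst.
by apply: cvg_norm; apply: cvgB => //; exact: cvg_cst.
Unshelve. all: end_near. Qed.

(* Summation by parts turns the gradient inequality at each step into one in
   which every difference of gradients is paired with all later increments. *)
Lemma psi_path_le (s : nat -> B) (m : nat) : s 0%N = 0 ->
  psi (s m) <=
    \sum_(0 <= k < m) (D (s k.+1) (s m - s k) - D (s k) (s m - s k)).
Proof.
move=> s0; elim: m => [|m IH].
  by rewrite big_geq// s0 /psi_p normr0 powR0 ?gt_eqF.
have step : \sum_(0 <= k < m.+1) (D (s k.+1) (s m.+1 - s k) - D (s k) (s m.+1 - s k))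
   = \sum_(0 <= k < m) (D (s k.+1) (s m - s k) - D (s k) (s m - s k))
     + D (s m.+1) (s m.+1 - s m).
  rewrite (eq_bigr (fun k => (D (s k.+1) (s m - s k) - D (s k) (s m - s k)) +
     (D (s k.+1) (s m.+1 - s m) - D (s k) (s m.+1 - s m)))); last first.
    move=> k _; rewrite -(subrKA (s m)) !(addrC (s m.+1 - s m)) !diff_psiD.
    by ring.
  (* The corrections telescope to [D (s m.+1)] of the last increment because [D 0] vanishes; in the
     main sum the term of index [m] is evaluated at 0. *)
  rewrite big_split/= telescope_sumr// s0 diff_psi0 subr0.
  by rewrite big_nat_recr//= subrr -(subrr 0) !diff_psiB !subrr addr0.
rewrite step; have := psi_sub_le (s m.+1) (s m.+1 - s m).
by rewrite subKr; lra.
Qed.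

End smooth_norm.

(** * Measurability with values in a separable space *)

Lemma separable_seq {R : realType} (B : normedModType R) : separable_space B ->
  exists e : nat -> B, e 0%N = 0 /\
    forall (x : B) (r : R), 0 < r -> exists k, `|x - e k| < r.
Proof.
move=> [D [/countable_injP[f finj] clD]].
(* [f] numbers the points of [D] and [e] inverts it, shifted by one to place the origin at index 0;
   numbers that code no point give 0. *)
pose e k := if k is k'.+1 then xget 0 [set y | D y /\ f y = k'] else 0.
exists e; split => // x r r0.
have : closure D x by rewrite clD.
move=> /(_ (ball x r)) [|y [Dy]]; first exact: nbhsx_ballx.
rewrite -ball_normE => /= xyr; exists (f y).+1 => /=.
case: xgetP => [z _ [Dz fzy]|/(_ y)]; last by case; split.
by rewrite (_ : z = y)//; apply: finj; rewrite ?inE.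
Qed.

Section G_measurability.
Context {d : measure_display} {T : measurableType d} {G : set (set T)}.
Hypothesis sG : sigma_algebra setT G.

(** Makes the closure properties of measurable sets available for the bare family [G]. *)
Lemma sigma_algebra_measurableE (A : set T) :
  G A <-> measurable (A : set (g_sigma_algebraType G)).
Proof. by rewrite /measurable/= sigma_algebra_id. Qed.

Lemma G_measurable_comp {S S' : topologicalType} (h : S -> S') (f : T -> S) :
  continuous h -> G_measurable G f -> G_measurable G (h \o f).
Proof. by move=> /continuousP ch mf O oO; exact: (mf (h @^-1` O) (ch O oO)). Qed.

Lemma G_measurable_cst {S : topologicalType} (a : S) :
  G_measurable G (fun=> a).
Proof.
move=> O _; apply/sigma_algebra_measurableE.
by rewrite preimage_cst; case: ifP.
Qed.

(** By separability an open set of the product is a countable union of rectangles of balls, with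
    centres in dense sequences and radii [1 / (n + 1)]. *)
Lemma G_measurable_pair {R : realType} {B B' : normedModType R}
    (X : T -> B) (Y : T -> B') :
  separable_space B -> separable_space B' ->
  G_measurable G X -> G_measurable G Y -> G_measurable G (fun w => (X w, Y w)).
Proof.
move=> /separable_seq[e [_ eP]] /separable_seq[e' [_ eP']] mX mY O oO.
pose r n : R := n.+1%:R^-1.
have r0 n : 0 < r n by rewrite invr_gt0 ltr0n.
pose good (i : nat * nat * nat) :=
  ball (e i.1.1) (r i.2) `*` ball (e' i.1.2) (r i.2) `<=` O.
pose V (i : nat * nat * nat) : set T := if `[< good i >] then
  X @^-1` ball (e i.1.1) (r i.2) `&` Y @^-1` ball (e' i.1.2) (r i.2) else set0.
have -> : (fun w => (X w, Y w)) @^-1` O = \bigcup_i V i.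
  apply/seteqP; split => [w /= Ow|w [i _]]; last first.
    rewrite /V; case: asboolP => // gi [Xi Yi].
    by apply: (gi (X w, Y w)); split.
  have : nbhs (X w, Y w) O by exact: open_nbhs_nbhs.
  move=> /nbhs_ballP[eps /= eps0 epsO].
  (* A ball of radius below [eps / 2] that contains [X w] stays within [eps] of it, and likewise for
     [Y w]. *)
  have [n neps] : exists n, r n < eps / 2.
    exists (Num.trunc (eps / 2)^-1).
    rewrite /r invf_plt ?posrE ?divr_gt0//.
    by rewrite truncnS_gt.
  have [k kP] := eP (X w) _ (r0 n); have [k' kP'] := eP' (Y w) _ (r0 n).
  exists ((k, k'), n) => //; rewrite /V; case: asboolP => [_|]; last first.
    case=> -[a b] /= [ak bk]; apply: epsO; split => /=.
      apply: (@ball_splitr _ _ (e k)).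
        by apply: (le_ball (ltW neps)); rewrite -ball_normE /ball_ /= distrC.
      by apply: (le_ball (ltW neps)).
    apply: (@ball_splitr _ _ (e' k')).
      by apply: (le_ball (ltW neps)); rewrite -ball_normE /ball_ /= distrC.
    by apply: (le_ball (ltW neps)).
  by split; rewrite /= -ball_normE /ball_ /= distrC.
apply/sigma_algebra_measurableE; apply: countable_bigcupT_measurable => // i.
apply/sigma_algebra_measurableE; rewrite /V; case: asboolP => _; last first.
  by case: sG.
have GI A A' : G A -> G A' -> G (A `&` A').
  move=> /sigma_algebra_measurableE mA /sigma_algebra_measurableE mA'.
  by apply/sigma_algebra_measurableE; exact: measurableI.
by apply: GI; [apply: mX|apply: mY]; exact: ball_open.
Qed.

Lemma G_measurable2 {R : realType} {B B' : normedModType R}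
    {S : topologicalType} (h : B * B' -> S) (X : T -> B) (Y : T -> B') :
  separable_space B -> separable_space B' -> continuous h ->
  G_measurable G X -> G_measurable G Y -> G_measurable G (fun w => h (X w, Y w)).
Proof.
move=> sB sB' ch mX mY.
exact: (G_measurable_comp ch (G_measurable_pair sB sB' mX mY)).
Qed.

Lemma G_measurable_addZ {R : realType} {B : normedModType R} (a : R)
    (X Y : T -> B) : separable_space B ->
  G_measurable G X -> G_measurable G Y ->
  G_measurable G (fun w => X w + a *: Y w).
Proof.
move=> sB; apply: (@G_measurable2 _ _ _ _ (fun z => z.1 + a *: z.2)) => // z.
by apply: cvgD; [exact: cvg_fst|apply: cvgZ; [exact: cvg_cst|exact: cvg_snd]].
Qed.

Lemma G_measurable_sum {R : realType} {B : normedModType R}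
    (s : seq nat) (X : nat -> T -> B) : separable_space B ->
  (forall i, i \in s -> G_measurable G (X i)) ->
  G_measurable G (fun w => \sum_(i <- s) X i w).
Proof.
move=> sB; elim: s => [_|i s IH mX].
  under eq_fun do rewrite big_nil; exact: G_measurable_cst.
under eq_fun do rewrite big_cons addrC -[X i _]scale1r.
apply: G_measurable_addZ => //; last by apply: mX; rewrite inE eqxx.
by apply: IH => j js; apply: mX; rewrite inE js orbT.
Qed.

Lemma G_measurable_lt {R : realType} (f : T -> R) (a : R) :
  G_measurable G f -> G [set w | f w < a].
Proof.
move=> mf; have := mf _ (@open_lt R a).
by congr G.
Qed.

Lemma G_measurable_gt {R : realType} (f : T -> R) (a : R) :
  G_measurable G f -> G [set w | a < f w].
Proof.
move=> mf; have := mf _ (@open_gt R a).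
by congr G.
Qed.

Lemma G_measurable_fun {R : realType} (f : T -> R) :
  G `<=` measurable -> G_measurable G f -> measurable_fun setT f.
Proof.
move=> Gm mf; apply: (measurability _ (RGenOpens.measurableE R)) => //.
by move=> _ [_ [a [b -> <-]]]; rewrite setTI; apply: Gm; apply: mf; exact: itv_open.
Qed.

End G_measurability.

(** * Replacing an integrand by its conditional expectation *)

Section nearest_point.
Context {R : realType} {B : normedModType R} (e : nat -> B).

(* A point of {0, e 0, ..., e (m - 1)} closest to [x]: a finitely valued
   approximation of [x] whose norm stays below 2 |x|. *)
Fixpoint nearest_point (x : B) (m : nat) : B :=
  if m is m'.+1 then
    if `|x - e m'| < `|x - nearest_point x m'| then e m' else nearest_point x m'
  else 0.

Lemma nearest_point_le (x : B) (m k : nat) : (k < m)%N ->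
  `|x - nearest_point x m| <= `|x - e k|.
Proof.
elim: m => // m IH; rewrite ltnS leq_eqVlt => /predU1P[->|km] /=.
  by case: ifPn => //; rewrite -leNgt.
by case: ifPn => [/ltW le1|_]; rewrite ?(le_trans le1)// IH.
Qed.

Lemma nearest_point_le_norm (x : B) (m : nat) :
  `|x - nearest_point x m| <= `|x|.
Proof.
elim: m => [|m IH] /=; first by rewrite subr0.
by case: ifPn => // /ltW le1; exact: le_trans IH.
Qed.

Lemma nearest_point_cvg (x : B) :
  (forall r, 0 < r -> exists k, `|x - e k| < r) ->
  nearest_point x m @[m --> \oo] --> x.
Proof.
move=> eP; apply/cvgrPdist_lt => r /eP[k xk].
exists k.+1 => // m /= km; exact: le_lt_trans (nearest_point_le _ km) xk.
Qed.

(** The choice between [e m] and the previous candidate depends on the sign of a continuous function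
    of two [G]-measurable maps, hence on an event of [G]. *)
Lemma G_measurable_nearest_point {d} {T : measurableType d} (G : set (set T))
    (U : T -> B) (m : nat) : sigma_algebra setT G -> separable_space B ->
  G_measurable G U -> G_measurable G (fun w => nearest_point (U w) m).
Proof.
move=> sG sB mU; elim: m => [|m IH]/=; first exact: G_measurable_cst.
pose h (z : B * B) := `|z.1 - e m| - `|z.1 - z.2|.
have ch : continuous h.
  move=> z; apply: cvgB; apply: cvg_norm; apply: cvgB.
  - exact: cvg_fst.
  - exact: cvg_cst.
  - exact: cvg_fst.
  - exact: cvg_snd.
have mh := G_measurable2 sG sB sB ch mU IH.
have G1 := G_measurable_lt 0 mh.
move=> O oO.
have -> : (fun w => if `|U w - e m| < `|U w - nearest_point (U w) m| then e m
    else nearest_point (U w) m) @^-1` O =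
  ([set w | h (U w, nearest_point (U w) m) < 0] `&` (fun=> e m) @^-1` O) `|`
  (~` [set w | h (U w, nearest_point (U w) m) < 0] `&`
     (fun w => nearest_point (U w) m) @^-1` O).
  apply/seteqP; split => w /=; rewrite /h/= subr_lt0; case: ifP => // lt1.
  - by left.
  - by right; split.
  - by move=> [[]|[]].
  - by move=> [[]|[]].
apply/(sigma_algebra_measurableE sG).
apply: measurableU; apply: measurableI; last 2 first.
- by apply: measurableC; apply/(sigma_algebra_measurableE sG).
- by apply/(sigma_algebra_measurableE sG); exact: IH.
- by apply/(sigma_algebra_measurableE sG).
- by apply/(sigma_algebra_measurableE sG); exact: G_measurable_cst.
Qed.

End nearest_point.

Section gradient_pairing.
Context {d : measure_display} {T : measurableType d} {R : realType}.
Context {P : probability T R} {B : normedModType R} {p C : R}.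
Context {D2 : B -> B -> B -> R}.
Hypotheses (p2 : 2 <= p) (C0 : 0 <= C) (sB : separable_space B).
Hypothesis psi_D2 : twice_diff_with (@psi_p R B p) D2.
Hypothesis D2_le : forall x u v : B,
  `|D2 x u v| <= C * `|x| `^ (p - 2) * `|u| * `|v|.
Local Notation D := (@dpsi R B p).
Implicit Types (U V X : T -> B) (A : set T).

Lemma measurable_dpsi U V :
  G_measurable measurable U -> G_measurable measurable V ->
  measurable_fun setT (fun w => D (U w) (V w)).
Proof.
move=> mU mV; apply: (@G_measurable_fun _ _ measurable) => //.
apply: (@G_measurable2 _ _ _ (sigma_algebra_measurable _) _ _ _ _
  (fun z : B * B => D z.1 z.2)) => //.
exact: (diff_psi_continuous p2 C0 psi_D2 D2_le).
Qed.

Lemma measurable_norm_B U : G_measurable measurable U ->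
  measurable_fun setT (fun w => `|U w|).
Proof.
move=> mU; apply: (@G_measurable_fun _ _ measurable) => //.
apply: (@G_measurable_comp _ _ _ _ _ (fun x : B => `|x|)) => // x.
exact: norm_continuous.
Qed.

Lemma integrable_dpsi_bounded A U V (M : R) : measurable A ->
  G_measurable measurable U -> G_measurable measurable V ->
  P.-integrable A (fun w => `|V w|%:E) -> (forall w, A w -> `|U w| <= M) ->
  P.-integrable A (fun w => (D (U w) (V w))%:E).
Proof.
move=> mA mU mV iV UM.
apply: (@le_integrable _ _ _ _ _ mA _
  (fun w => (C * M `^ (p - 2) * M)%:E * `|V w|%:E)%E); last first.
- exact: integrableZl.
- move=> w Aw; rewrite -EFinM !abse_EFin lee_fin.
  have M0 : 0 <= M by apply: le_trans (UM w Aw).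
  rewrite (le_trans (diff_psi_growth p2 C0 psi_D2 D2_le _ _))//.
  rewrite ger0_norm ?mulr_ge0 ?powR_ge0// ler_wpM2r// ler_pM ?mulr_ge0 ?powR_ge0//.
    rewrite ler_wpM2l//; apply: ge0_ler_powR; rewrite ?nnegrE ?subr_ge0//.
    exact: UM.
  exact: UM.
- by apply/measurable_EFinP; apply: measurable_funTS; exact: measurable_dpsi.
Qed.

Section pairing.
Variables (G : set (set T)) (V1 V2 : T -> B).
Hypotheses (sG : sigma_algebra setT G) (Gm : G `<=` measurable).
Hypotheses (mV1 : G_measurable measurable V1) (mV2 : G_measurable measurable V2).
Hypotheses (iV1 : P.-integrable setT (fun w => `|V1 w|%:E))
           (iV2 : P.-integrable setT (fun w => `|V2 w|%:E)).
Hypothesis V12 : forall f : B -> R, cont_lin_functional f -> forall A, G A ->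
  (\int[P]_(w in A) (f (V1 w))%:E = \int[P]_(w in A) (f (V2 w))%:E)%E.

Lemma G_measurableW U : G_measurable G U -> G_measurable measurable U.
Proof. by move=> mU O oO; apply: Gm; exact: mU. Qed.

(** Where [e m] is selected, the gradient is a fixed continuous functional and [V12] applies;
    elsewhere the previous candidate is in force. As [A] gets split, the induction ranges over all
    events of [G]. *)
Lemma integral_dpsi_nearest_eq (e : nat -> B) U m A : G_measurable G U -> G A ->
  (\int[P]_(w in A) (D (nearest_point e (U w) m) (V1 w))%:E =
   \int[P]_(w in A) (D (nearest_point e (U w) m) (V2 w))%:E)%E.
Proof.
move=> mU; elim: m A => [|m IH] A GA /=.
  by apply: V12 => //; exact: (diff_psi_functional psi_D2).
pose h (z : B * B) := `|z.1 - e m| - `|z.1 - z.2|.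
have ch : continuous h.
  move=> z; apply: cvgB; apply: cvg_norm; apply: cvgB.
  - exact: cvg_fst.
  - exact: cvg_cst.
  - exact: cvg_fst.
  - exact: cvg_snd.
have mN k := G_measurable_nearest_point e k sG sB mU.
have mh := G_measurable2 sG sB sB ch mU (mN m).
have G1 := G_measurable_lt 0 mh.
set A1 := [set w | _] in G1.
have GA1 : G (A `&` A1).
  move: GA G1 => /(sigma_algebra_measurableE sG) ? /(sigma_algebra_measurableE sG) ?.
  by apply/(sigma_algebra_measurableE sG); exact: measurableI.
have GA2 : G (A `\` A1).
  move: GA G1 => /(sigma_algebra_measurableE sG) ? /(sigma_algebra_measurableE sG) ?.
  by apply/(sigma_algebra_measurableE sG); exact: measurableD.
have A12 : [disjoint A `&` A1 & A `\` A1].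
  by apply/disj_setPS => w [[_ ?] [_]].
have EA : A = (A `&` A1) `|` (A `\` A1) by rewrite setUIDK.
have mf V : G_measurable measurable V -> measurable_fun setT (fun w =>
    (D (nearest_point e (U w) m.+1) (V w))%:E).
  by move=> mV; apply/measurable_EFinP; apply: measurable_dpsi => //; exact/G_measurableW.
rewrite EA !integral_setU//; try exact: Gm.
- congr (_ + _)%E.
    transitivity (\int[P]_(w in A `&` A1) (D (e m) (V1 w))%:E)%E.
      by apply: eq_integral => w /[!inE] -[_]; rewrite /A1 /h/= subr_lt0 => ->.
    rewrite V12//; last exact: (diff_psi_functional psi_D2).
    by apply: eq_integral => w /[!inE] -[_]; rewrite /A1 /h/= subr_lt0 => ->.
  transitivity (\int[P]_(w in A `\` A1) (D (nearest_point e (U w) m) (V1 w))%:E)%E.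
    apply: eq_integral => w /[!inE] -[_]; rewrite /A1 /h/= subr_lt0 => /negP.
    by move=> /negbTE ->.
  rewrite IH//; apply: eq_integral => w /[!inE] -[_].
  by rewrite /A1 /h/= subr_lt0 => /negP /negbTE ->.
- exact: measurable_funTS (mf _ mV2).
- exact: measurable_funTS (mf _ mV1).
Qed.

(** Passage to the limit from nearest points to [U]. On [A] the approximations have norm at most
    [M + M], so a multiple of the norm of the second argument dominates. *)
Lemma integral_dpsi_bounded_eq U (M : R) A : G_measurable G U -> G A ->
  (forall w, A w -> `|U w| <= M) ->
  (\int[P]_(w in A) (D (U w) (V1 w))%:E = \int[P]_(w in A) (D (U w) (V2 w))%:E)%E.
Proof.
move=> mU GA UM; have mA := Gm GA.
have [e [_ eP]] := separable_seq sB.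
have lim V : G_measurable measurable V -> P.-integrable setT (fun w => `|V w|%:E) ->
    (\int[P]_(w in A) (D (nearest_point e (U w) m) (V w))%:E)%E @[m --> \oo] -->
    (\int[P]_(w in A) (D (U w) (V w))%:E)%E.
  move=> mV iV.
  have [] := @dominated_convergence _ T R P A mA
    (fun m w => (D (nearest_point e (U w) m) (V w))%:E)
    (fun w => (D (U w) (V w))%:E)
    (fun w => (C * (M + M) `^ (p - 2) * (M + M))%:E * `|V w|%:E)%E => //.
  - move=> m; apply/measurable_EFinP; apply: measurable_funTS.
    apply: measurable_dpsi => //; apply: G_measurableW; exact: G_measurable_nearest_point.
  - by apply/measurable_EFinP; apply: measurable_funTS; apply: measurable_dpsi; first exact: G_measurableW.
  - apply: aeW => w Aw; apply: cvg_EFin; first by apply: nearW.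
    have cD := diff_psi_continuous p2 C0 psi_D2 D2_le.
    have {}cD := cD (U w, V w).
    apply: (@cvg_comp _ _ _ (fun m => (nearest_point e (U w) m, V w))
      (fun z : B * B => D z.1 z.2) _ _ _ _ cD).
    apply: cvg_pair => /=; last exact: cvg_cst.
    by apply: nearest_point_cvg => r r0; exact: eP.
  - by apply: integrableZl => //; exact: integrableS iV.
  - apply: aeW => w m Aw; rewrite -EFinM !abse_EFin lee_fin.
    have M0 : 0 <= M by apply: le_trans (UM w Aw).
    have NM : `|nearest_point e (U w) m| <= M + M.
      rewrite -(subKr (U w) (nearest_point _ _ _)) (le_trans (ler_normB _ _))//.
      rewrite lerD ?UM// (le_trans (nearest_point_le_norm _ _ _))// UM//.
    rewrite (le_trans (diff_psi_growth p2 C0 psi_D2 D2_le _ _))//.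
    rewrite ler_wpM2r// ler_pM ?mulr_ge0 ?powR_ge0//.
    rewrite ler_wpM2l//; apply: ge0_ler_powR; rewrite ?nnegrE ?subr_ge0 ?addr_ge0//.
have := lim _ mV2 iV2; under eq_fun do rewrite -integral_dpsi_nearest_eq//.
by move=> /cvg_lim <-//; have := lim _ mV1 iV1 => /cvg_lim <-.
Qed.

(** Only the difference of the gradients is assumed integrable. The integral is split on the events
    [An n], where both base points are bounded, and dominated convergence with the difference itself
    as majorant gives the equality on [A]. *)
Lemma integral_dpsi_diff_eq U1 U2 A : G_measurable G U1 -> G_measurable G U2 ->
  G A ->
  P.-integrable A (fun w => (D (U1 w) (V1 w) - D (U2 w) (V1 w))%:E) ->
  P.-integrable A (fun w => (D (U1 w) (V2 w) - D (U2 w) (V2 w))%:E) ->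
  \int[P]_(w in A) (D (U1 w) (V1 w) - D (U2 w) (V1 w)) =
  \int[P]_(w in A) (D (U1 w) (V2 w) - D (U2 w) (V2 w)).
Proof.
move=> mU1 mU2 GA i1 i2; rewrite /Rintegral; congr fine.
have mA := Gm GA.
pose An n := A `&` ([set w | `|U1 w| < n%:R] `&` [set w | `|U2 w| < n%:R]).
have GU U n : G_measurable G U -> G [set w | `|U w| < n%:R].
  by move=> mU; apply: G_measurable_lt;
    apply: (@G_measurable_comp _ _ _ _ _ (fun x : B => `|x|)) => // x;
    exact: norm_continuous.
have GAn n : G (An n).
  move: (GA) (GU _ n mU1) (GU _ n mU2) => /(sigma_algebra_measurableE sG) ?.
  move=> /(sigma_algebra_measurableE sG) ? /(sigma_algebra_measurableE sG) ?.
  by apply/(sigma_algebra_measurableE sG); do 2?apply: measurableI.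
have lim V : G_measurable measurable V ->
    P.-integrable A (fun w => (D (U1 w) (V w) - D (U2 w) (V w))%:E) ->
    (\int[P]_(w in An n) (D (U1 w) (V w) - D (U2 w) (V w))%:E)%E @[n --> \oo] -->
    (\int[P]_(w in A) (D (U1 w) (V w) - D (U2 w) (V w))%:E)%E.
  move=> mV iV; pose f w := (D (U1 w) (V w) - D (U2 w) (V w))%:E.
  have mf : measurable_fun A f by case/integrableP: iV.
  pose Bn n := [set w | `|U1 w| < n%:R] `&` [set w | `|U2 w| < n%:R].
  have mBn n : measurable (Bn n).
    by apply: measurableI; apply: Gm; apply: GU.
  have -> : (fun n => \int[P]_(w in An n) f w)%E =
      (fun n => \int[P]_(w in A) (f \_ (Bn n)) w)%E.
    by apply/funext => n; rewrite integral_mkcondr.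
  have [] := @dominated_convergence _ T R P A mA (fun n => f \_ (Bn n)) f
    (fun w => `|f w|)%E => //.
  - by move=> n; apply/measurable_restrict => //; exact: measurable_funS mf.
  - apply: aeW => w Aw; apply: cvg_near_cst.
    exists (Num.trunc (Num.max `|U1 w| `|U2 w|)).+1 => // n /= ltn.
    rewrite patchE; case: ifPn => //; rewrite notin_setE; case.
    have lt1 : Num.max `|U1 w| `|U2 w| < n%:R.
      by rewrite (lt_le_trans (truncnS_gt _))// ler_nat.
    by split => /=; rewrite (le_lt_trans _ lt1)// le_max lexx ?orbT.
  - exact: integrable_abse.
  - apply: aeW => w n Aw; rewrite patchE; case: ifPn => // _.
    by rewrite abse0 abse_ge0.
have eqn n : (\int[P]_(w in An n) (D (U1 w) (V1 w) - D (U2 w) (V1 w))%:E =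
    \int[P]_(w in An n) (D (U1 w) (V2 w) - D (U2 w) (V2 w))%:E)%E.
  have mAn := Gm (GAn n).
  have b1 w : An n w -> `|U1 w| <= n%:R by move=> [_ [/ltW]].
  have b2 w : An n w -> `|U2 w| <= n%:R by move=> [_ [_ /ltW]].
  have iD U V : G_measurable G U -> G_measurable measurable V ->
      P.-integrable setT (fun w => `|V w|%:E) ->
      (forall w, An n w -> `|U w| <= n%:R) ->
      P.-integrable (An n) (fun w => (D (U w) (V w))%:E).
    move=> mU mV iV bU; apply: integrable_dpsi_bounded bU => //.
      exact: G_measurableW.
    exact: integrableS iV.
  under eq_integral do rewrite EFinB.
  under [RHS]eq_integral do rewrite EFinB.
  rewrite !integralB//; try by apply: iD.
  by rewrite (integral_dpsi_bounded_eq mU1 (GAn n) b1) (integral_dpsi_bounded_eq mU2 (GAn n) b2).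
have := lim _ mV2 i2; under eq_fun do rewrite -eqn.
by move=> /cvg_lim <-//; have := lim _ mV1 i1 => /cvg_lim <-.
Qed.

End pairing.
End gradient_pairing.

(** * Differentiation under the integral *)

Lemma powR_add_le {R : realType} (p a b : R) : 0 <= p -> 0 <= a -> 0 <= b ->
  (a + b) `^ p <= 2 `^ p * (a `^ p + b `^ p).
Proof.
move=> p0 a0 b0; wlog ab : a b a0 b0 / a <= b => [H|].
  have [|/ltW] := leP a b; first exact: H.
  by rewrite addrC (addrC (_ `^ _)); exact: H.
apply: (@le_trans _ _ ((2 * b) `^ p)).
  by apply: ge0_ler_powR; rewrite ?nnegrE ?addr_ge0 ?mulr_ge0// mulr2n mulrDl mul1r lerD2r.
by rewrite powRM// ler_wpM2l ?powR_ge0// lerDr powR_ge0.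
Qed.

Lemma young_powR {R : realType} (p a y : R) : 2 <= p -> 0 <= a -> 0 <= y ->
  a `^ (p - 2) * y <= a `^ p + y `^ (p / 2).
Proof.
move=> p2 a0 y0; have p0 : 0 < p by lra.
have := scaled_young p2 ltr01 ltr01 a0 y0.
rewrite !powR1 !divr1 !mul1r => /le_trans; apply.
have q0 : 0 <= 2 / p by rewrite divr_ge0// ltW.
have q1 : 2 / p <= 1 by rewrite ler_pdivrMr// mul1r.
rewrite lerD//.
  by rewrite ler_piMl ?powR_ge0// lerBlDr lerDl.
by rewrite ler_piMl ?powR_ge0.
Qed.

Section gradient_flow.
Context {d : measure_display} {T : measurableType d} {R : realType}.
Context {P : probability T R} {B : normedModType R} {p C : R}.
Context {D2 : B -> B -> B -> R}.
Hypotheses (p2 : 2 <= p) (C0 : 0 <= C) (sB : separable_space B).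
Hypothesis psi_D2 : twice_diff_with (@psi_p R B p) D2.
Hypothesis D2_le : forall x u v : B,
  `|D2 x u v| <= C * `|x| `^ (p - 2) * `|u| * `|v|.
Local Notation D := (@dpsi R B p).
Context {A : set T}.
Hypothesis mA : measurable A.

Let p0 : 0 < p. Proof. exact: lt_le_trans p2. Qed.

Lemma measurable_norm_powR (U : T -> B) (q : R) : G_measurable measurable U ->
  measurable_fun A (fun w => `|U w| `^ q).
Proof.
move=> mU; apply: (@measurableT_comp _ _ _ _ _ _ (fun x : R => x `^ q)).
  exact: measurable_powR.
by apply: measurable_funTS; exact: measurable_norm_B.
Qed.

Lemma integrable_powR_addZ (U X : T -> B) (s : R) :
  G_measurable measurable U -> G_measurable measurable X ->
  P.-integrable A (fun w => (`|U w| `^ p)%:E) ->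
  P.-integrable A (fun w => (`|X w| `^ p)%:E) ->
  P.-integrable A (fun w => (`|U w + s *: X w| `^ p)%:E).
Proof.
move=> mU mX iU iX.
pose g w := 2 `^ p * (`|U w| `^ p + `|s| `^ p * `|X w| `^ p).
have ig : P.-integrable A (EFin \o g).
  exact: (integrableZl mA _ (integrableD mA iU (integrableZl mA _ iX))).
apply: (le_integrable mA _ _ ig).
- apply/measurable_EFinP; apply: measurable_norm_powR.
  by apply: G_measurable_addZ => //; exact: sigma_algebra_measurable.
- move=> w _; rewrite !abse_EFin lee_fin.
  rewrite !ger0_norm ?mulr_ge0 ?addr_ge0 ?mulr_ge0 ?powR_ge0// /g.
  rewrite -powRM//; apply: le_trans (powR_add_le _ _ _) => //; last exact: ltW.
  apply: ge0_ler_powR; rewrite ?nnegrE ?(ltW p0) ?addr_ge0 ?mulr_ge0//.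
  by rewrite -normrZ ler_normD.
Qed.

Variables (U X V : T -> B).
Hypotheses (mU : G_measurable measurable U) (mX : G_measurable measurable X)
           (mV : G_measurable measurable V).
Hypotheses (iU : P.-integrable A (fun w => (`|U w| `^ p)%:E))
           (iX : P.-integrable A (fun w => (`|X w| `^ p)%:E)).
Hypothesis iXV : P.-integrable A
  (fun w => (`|X w| `^ (p / 2) * `|V w| `^ (p / 2))%:E).

(** Up to constants, an integrable majorant of the gradient difference and of its derivative for all
    [|s| <= 2]. This range has the endpoints of [0, 1] in its interior, so that derivatives exist
    there too. *)
Let dom w := (`|U w| + 2 * `|X w|) `^ p + `|X w| `^ (p / 2) * `|V w| `^ (p / 2).

Let dom_ge0 w : 0 <= dom w.
Proof. by rewrite addr_ge0 ?mulr_ge0 ?powR_ge0. Qed.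

Let dom_integrable : P.-integrable A (EFin \o dom).
Proof.
rewrite (_ : _ \o _ = (fun w => ((`|U w| + 2 * `|X w|) `^ p)%:E) \+
  (fun w => (`|X w| `^ (p / 2) * `|V w| `^ (p / 2))%:E))%E//.
apply: integrableD => //.
pose g w := 2 `^ p * (`|U w| `^ p + 2 `^ p * `|X w| `^ p).
have ig : P.-integrable A (EFin \o g).
  exact: (integrableZl mA _ (integrableD mA iU (integrableZl mA _ iX))).
apply: (le_integrable mA _ _ ig).
- apply/measurable_EFinP.
  apply: (@measurableT_comp _ _ _ _ _ _ (fun x : R => x `^ p)).
    exact: measurable_powR.
  apply: measurable_funTS; apply: measurable_funD; first exact: measurable_norm_B.
  by apply: measurable_funM => //; exact: measurable_norm_B.
- move=> w _; rewrite !abse_EFin lee_fin.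
  rewrite !ger0_norm ?mulr_ge0 ?addr_ge0 ?mulr_ge0 ?powR_ge0// /g.
  rewrite -powRM//; apply: powR_add_le => //; first exact: ltW.
Qed.

Let dom_young w : (`|U w| + 2 * `|X w|) `^ (p - 2) * `|X w| * `|V w| <= dom w.
Proof.
rewrite /dom -powRM// -mulrA.
by apply: young_powR => //; rewrite ?addr_ge0 ?mulr_ge0.
Qed.

Let dpsi_diff_dom (s : R) w : `|s| <= 2 ->
  `|D (U w + s *: X w) (V w) - D (U w) (V w)| <= 2 * C * dom w.
Proof.
move=> s2; rewrite (le_trans (diff_psi_lip p2 C0 psi_D2 D2_le _ _ _))//.
have e1 : `|s *: X w| <= 2 * `|X w| by rewrite normrZ ler_wpM2r.
have e2 : (`|U w| + `|s *: X w|) `^ (p - 2) <= (`|U w| + 2 * `|X w|) `^ (p - 2).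
  apply: ge0_ler_powR; rewrite ?nnegrE ?subr_ge0 ?addr_ge0 ?mulr_ge0//.
  by rewrite lerD2l.
apply: (@le_trans _ _ (C * (`|U w| + 2 * `|X w|) `^ (p - 2) * (2 * `|X w|) * `|V w|)).
  by rewrite ler_wpM2r// ler_pM ?mulr_ge0 ?powR_ge0// ler_wpM2l.
have -> : C * (`|U w| + 2 * `|X w|) `^ (p - 2) * (2 * `|X w|) * `|V w| =
  2 * C * ((`|U w| + 2 * `|X w|) `^ (p - 2) * `|X w| * `|V w|) by ring.
by rewrite ler_wpM2l// mulr_ge0.
Qed.

Let D2_dom (s : R) w : `|s| <= 2 ->
  `|D2 (U w + s *: X w) (X w) (V w)| <= C * dom w.
Proof.
move=> s2; rewrite (le_trans (D2_le _ _ _))//.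
apply: (@le_trans _ _ (C * ((`|U w| + 2 * `|X w|) `^ (p - 2) * `|X w| * `|V w|))).
  rewrite -!mulrA ler_wpM2l// ler_wpM2r ?mulr_ge0//.
  apply: ge0_ler_powR; rewrite ?nnegrE ?subr_ge0 ?addr_ge0 ?mulr_ge0//.
  by rewrite (le_trans (ler_normD _ _))// lerD2l normrZ ler_wpM2r.
by rewrite ler_wpM2l.
Qed.

Lemma measurable_dpsi_diff (s : R) :
  measurable_fun A (fun w => D (U w + s *: X w) (V w) - D (U w) (V w)).
Proof.
apply: measurable_funTS; apply: measurable_funB;
  apply: (measurable_dpsi p2 C0 sB psi_D2 D2_le) => //.
by apply: G_measurable_addZ => //; exact: sigma_algebra_measurable.
Qed.

Lemma integrable_dpsi_diff (s : R) : `|s| <= 2 ->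
  P.-integrable A (fun w => (D (U w + s *: X w) (V w) - D (U w) (V w))%:E).
Proof.
move=> s2; apply: (@le_integrable _ _ _ _ _ mA _
    (fun w => (2 * C)%:E * (dom w)%:E)%E).
- by apply/measurable_EFinP; exact: measurable_dpsi_diff.
- move=> w _; rewrite -EFinM !abse_EFin lee_fin [leRHS]ger0_norm.
    exact: dpsi_diff_dom.
  by rewrite !mulr_ge0.
- exact: integrableZl.
Qed.

(** The second derivative is the pointwise limit of measurable difference quotients with steps
    [1 / (n + 1)]. *)
Lemma measurable_D2 (s : R) :
  measurable_fun A (fun w => D2 (U w + s *: X w) (X w) (V w)).
Proof.
pose f s w := D (U w + s *: X w) (V w) - D (U w) (V w).
pose u (n : nat) : R := n.+1%:R^-1.
apply: (@measurable_fun_cvg _ _ _ _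
  (fun n w => (u n)^-1 * (f (u n + s) w - f s w))).
  by move=> n; apply: measurable_funM => //; apply: measurable_funB;
    exact: measurable_dpsi_diff.
move=> w _.
have [drv /= E] := diff_psi_is_derive psi_D2 (U w) (X w) (V w) s.
have cv := drv; rewrite /derivable in cv.
have u0 : (forall n, u n != 0) /\ u n @[n --> \oo] --> 0.
  by split=> [n|]; [rewrite invr_eq0 pnatr_eq0|exact: cvg_harmonic].
have := (cvgr_dnbhsP _ _ _).1 cv u u0; rewrite -/(derive _ _ _) E.
apply: cvg_trans; apply: near_eq_cvg; apply: nearW => n /=.
by rewrite /f opprB addrA subrK [u n *: 1]mulr1.
Qed.

(** Differentiation under the integral sign on ]-2, 2[ with majorant [C * dom w]. The subtracted
    [D (U w) (V w)] is constant in [s] and makes the integrand integrable. *)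
Lemma integral_dpsi_diff_is_derive (s : R) : `|s| < 2 ->
  is_derive s 1
    (fun s => \int[P]_(w in A) (D (U w + s *: X w) (V w) - D (U w) (V w)))
    (\int[P]_(w in A) D2 (U w + s *: X w) (X w) (V w)).
Proof.
move=> s2; pose f s w := D (U w + s *: X w) (V w) - D (U w) (V w).
have fdrv (t : R) w : is_derive t 1 (f ^~ w) (D2 (U w + t *: X w) (X w) (V w)).
  have h := diff_psi_is_derive psi_D2 (U w) (X w) (V w) t.
  by rewrite -[D2 _ _ _]subr0; apply: is_deriveB.
have Is : `]-2, 2[%classic s by rewrite /= in_itv/= -ltr_norml.
have intf t : `]-2, 2[%classic t -> P.-integrable A (EFin \o f t).
  by rewrite /= in_itv/= -ltr_norml => /ltW; exact: integrable_dpsi_diff.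
have derf t w : `]-2, 2[%classic t -> A w -> derivable (f ^~ w) t 1.
  by move=> _ _; have [] := fdrv t w.
have G0 w : 0 <= (C * dom w) by rewrite mulr_ge0.
have iG : P.-integrable A (EFin \o (fun w => C * dom w)).
  by rewrite (_ : _ \o _ = (fun w => C%:E * (dom w)%:E)%E)//; exact: integrableZl.
have d1E t w : lebesgue_integral_under.partial1of2 f t w = D2 (U w + t *: X w) (X w) (V w).
  rewrite lebesgue_integral_under.partial1of2E.
  by have [] := fdrv t w.
have ub t w : `]-2, 2[%classic t -> A w ->
    `|lebesgue_integral_under.partial1of2 f t w| <= C * dom w.
  by rewrite /= in_itv/= -ltr_norml d1E => /ltW ? _; exact: D2_dom.
apply: DeriveDef.
  exact: (@derivable_under_integral _ _ _ _ f A mA s (-2) 2 Is intf derf _ G0 iG ub).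
rewrite -derive1E.
rewrite (@differentiation_under_integral _ _ _ _ f A mA s (-2) 2 Is intf derf _ G0 iG ub).
by apply: eq_Rintegral => w _; exact: d1E.
Qed.

Lemma integral_D2_le (s H b : R) : 0 < H -> 0 < b -> `|s| <= 2 ->
  \int[P]_(w in A) (`|U w + s *: X w| `^ p) <= H ->
  \int[P]_(w in A) (`|X w| `^ (p / 2) * `|V w| `^ (p / 2)) <= b `^ (p / 2) ->
  \int[P]_(w in A) D2 (U w + s *: X w) (X w) (V w) <= C * (H `^ (1 - 2 / p) * b).
Proof.
move=> H0 b0 s2 UH XVb.
have q0 : 0 <= 2 / p by rewrite divr_ge0// ltW.
have q1 : 0 <= 1 - 2 / p by rewrite subr_ge0 ler_pdivrMr// mul1r.
pose k := C * (H `^ (1 - 2 / p) * b).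
have k0 : 0 <= k by rewrite !mulr_ge0 ?powR_ge0// ltW.
(* The coefficients of [scaled_young] times [C]. Once the bounds [H] and [b^(p/2)] are inserted, the
   weights [1 - 2 / p] and [2 / p] add up to 1 and [k] remains. *)
pose a1 := k * ((1 - 2 / p) / H); pose a2 := k * (2 / p / b `^ (p / 2)).
have a10 : 0 <= a1 by rewrite mulr_ge0// divr_ge0// ltW.
have a20 : 0 <= a2 by rewrite mulr_ge0// divr_ge0// ltW// powR_gt0.
have iU' := integrable_powR_addZ s mU mX iU iX.
have i1 : P.-integrable A (EFin \o (fun w => a1 * `|U w + s *: X w| `^ p)).
  by rewrite (_ : _ \o _ = (fun w => a1%:E * (`|U w + s *: X w| `^ p)%:E)%E)//;
    exact: integrableZl.
have i2 : P.-integrable A (EFin \o (fun w => a2 * (`|X w| `^ (p / 2) * `|V w| `^ (p / 2)))).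
  by rewrite (_ : _ \o _ = (fun w => a2%:E * (`|X w| `^ (p / 2) * `|V w| `^ (p / 2))%:E)%E)//;
    exact: integrableZl.
apply: (@le_trans _ _ (\int[P]_(w in A) (a1 * `|U w + s *: X w| `^ p +
   a2 * (`|X w| `^ (p / 2) * `|V w| `^ (p / 2))))).
  apply: le_Rintegral => //.
  - apply: (@le_integrable _ _ _ _ _ mA _ (fun w => C%:E * (dom w)%:E)%E).
    + by apply/measurable_EFinP; exact: measurable_D2.
    + move=> w _; rewrite -EFinM !abse_EFin lee_fin [leRHS]ger0_norm ?mulr_ge0//.
      exact: D2_dom.
    + exact: integrableZl.
  - exact: (integrableD mA i1 i2).
  - move=> w _; rewrite (le_trans (ler_norm _))// (le_trans (D2_le _ _ _))//.
    have := scaled_young p2 H0 b0 (normr_ge0 (U w + s *: X w))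
      (mulr_ge0 (normr_ge0 (X w)) (normr_ge0 (V w))).
    move=> /(ler_wpM2l C0); rewrite powRM// !mulrA => /le_trans; apply.
    by rewrite /a1 /a2 /k le_eqVlt; apply/orP; left; apply/eqP; ring.
rewrite RintegralD// !RintegralZl//.
have -> : C * (H `^ (1 - 2 / p) * b) = a1 * H + a2 * b `^ (p / 2).
  rewrite -/k /a1 /a2 -(mulrA k) divfK ?gt_eqF//.
  by rewrite -(mulrA k) divfK ?gt_eqF ?powR_gt0// -mulrDr subrK mulr1.
by rewrite lerD// ler_wpM2l.
Qed.

End gradient_flow.

(** * Two differential inequalities *)

Lemma is_derive_affine {R : realType} (a b s : R) :
  is_derive s 1 (fun s : R => a + s * b) b.
Proof.
have h := is_deriveD (is_derive_cst a s 1) (is_deriveZ b (is_derive_id s 1)).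
have -> : (fun s : R => a + s * b) = cst a + b \*: id.
  by apply/funext => x; rewrite !fctE /= [_ *: _]mulrC.
by apply: is_derive_eq h _; rewrite add0r [_ *: _]mulr1.
Qed.

(** Since [C = K^2 p / 2], the assumed bound on [dg] is exactly the derivative of
    [K^p (beta + s b)^(p/2)]. *)
Lemma sharp_flow_bound {R : realType} (p C K b beta : R) (g dg : R -> R) :
  2 <= p -> 0 < K -> C = K `^ 2 * (p / 2) -> 0 < b -> 0 < beta ->
  (forall s : R, s \in `[0, 1]%R -> is_derive s 1 g (dg s)) ->
  (forall s : R, s \in `]0, 1[%R ->
    dg s <= C * ((K `^ p * (beta + s * b) `^ (p / 2)) `^ (1 - 2 / p) * b)) ->
  g 1 - g 0 <= K `^ p * (beta + b) `^ (p / 2) - K `^ p * beta `^ (p / 2).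
Proof.
move=> p2 K0 CE b0 beta0 gdg dgle; have p0 : 0 < p by exact: lt_le_trans p2.
pose f s := K `^ p * (beta + s * b) `^ (p / 2).
pose df s := K `^ p * (p / 2 * (beta + s * b) `^ (p / 2 - 1) * b).
have f01 : K `^ p * (beta + b) `^ (p / 2) - K `^ p * beta `^ (p / 2) = f 1 - f 0.
  by rewrite /f mul1r mul0r addr0.
rewrite f01; apply: (@le_increment_derive _ g f dg df) => //.
- move=> s; rewrite in_itv/= => /andP[s0 s1].
  have bs0 : 0 < beta + s * b by rewrite ltr_wpDr// mulr_ge0// ltW.
  have l := is_derive_affine beta b s.
  have c := @is_derive1_comp R (fun x => x `^ (p / 2)) (fun s : R => beta + s * b)
    s _ _ (is_derive1_powR (p / 2) bs0) l.
  exact: (is_deriveZ (K `^ p) c).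
move=> s s01; apply: (le_trans (dgle _ s01)).
move: s01; rewrite in_itv/= => /andP[s0 s1].
have bs0 : 0 < beta + s * b by rewrite ltr_wpDr// mulr_ge0// ltW.
rewrite powRM ?powR_ge0// -!powRrM.
rewrite (_ : p * (1 - 2 / p) = p - 2); last by field; rewrite gt_eqF.
rewrite (_ : p / 2 * (1 - 2 / p) = p / 2 - 1); last by field; rewrite gt_eqF.
rewrite CE /df (_ : K `^ p = K `^ 2 * K `^ (p - 2)).
  have -> : K `^ 2 * K `^ (p - 2) * (p / 2 * (beta + s * b) `^ (p / 2 - 1) * b) =
    K `^ 2 * (p / 2) * (K `^ (p - 2) * (beta + s * b) `^ (p / 2 - 1) * b) by ring.
  exact: lexx.
by rewrite -powRD ?subrKC// (gt_eqF K0) implybT.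
Qed.

(** The power [2 / p] linearises the inequality: with [a = K^p beta^(p/2)], the function
    [v = (a + g)^(2/p)] starts at [K^2 beta] and has derivative at most [(2 / p) C b = K^2 b].
    Nonnegativity of [g] keeps the base of the power positive. *)
Lemma bihari_flow_bound {R : realType} (p C K b beta t : R) (g dg : R -> R) :
  2 <= p -> 0 < K -> C = K `^ 2 * (p / 2) -> 0 < b -> 0 < beta ->
  0 <= t -> g 0 = 0 ->
  (forall s : R, s \in `[0, t]%R -> 0 <= g s) ->
  (forall s : R, s \in `[0, t]%R -> is_derive s 1 g (dg s)) ->
  (forall s : R, s \in `]0, t[%R ->
    dg s <= C * ((K `^ p * beta `^ (p / 2) + g s) `^ (1 - 2 / p) * b)) ->
  K `^ p * beta `^ (p / 2) + g t <= K `^ p * (beta + t * b) `^ (p / 2).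
Proof.
move=> p2 K0 CE b0 beta0 t0 g0 gge0 gdg dgle.
have p0 : 0 < p by exact: lt_le_trans p2.
pose a := K `^ p * beta `^ (p / 2).
have a0 : 0 < a by rewrite mulr_gt0 ?powR_gt0.
have u0 (s : R) : s \in `[0, t]%R -> 0 < a + g s by move=> /gge0 ?; rewrite ltr_wpDr.
pose v s := (a + g s) `^ (2 / p).
pose dv s := 2 / p * (a + g s) `^ (2 / p - 1) * dg s.
pose l s := 0 + s * (K `^ 2 * b).
have KpE : (K `^ p) `^ (2 / p) = K `^ 2.
  by rewrite -powRrM mulrC divfK// gt_eqF.
have hyp1 (s : R) : s \in `[0, t]%R -> is_derive s 1 v (dv s).
  move=> st.
  have c : is_derive s 1 (fun s => a + g s) (dg s).
    by rewrite -[dg s]add0r; exact: (is_deriveD (is_derive_cst a s 1) (gdg _ st)).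
  exact: (@is_derive1_comp R (fun x => x `^ (2 / p)) (fun s => a + g s) s _ _
    (is_derive1_powR (2 / p) (u0 _ st)) c).
have hyp2 (s : R) : s \in `[0, t]%R -> is_derive s 1 l (K `^ 2 * b).
  by move=> _; exact: is_derive_affine.
have hyp3 (s : R) : s \in `]0, t[%R -> dv s <= K `^ 2 * b.
  move=> st; have st' : s \in `[0, t]%R.
    by move: st; rewrite !in_itv/= => /andP[/ltW-> /ltW->].
  have := dgle _ st; rewrite -/a => le1.
  have k0 : 0 <= 2 / p * (a + g s) `^ (2 / p - 1).
    by rewrite mulr_ge0 ?powR_ge0// divr_ge0// ltW.
  apply: (le_trans (ler_wpM2l k0 le1)).
  rewrite CE -(opprB 1) powRN.
  have n0 : (a + g s) `^ (1 - 2 / p) != 0 by rewrite gt_eqF// powR_gt0// u0.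
  rewrite le_eqVlt; apply/orP; left; apply/eqP; field.
  by rewrite n0 gt_eqF.
have := le_increment_derive t0 hyp1 hyp2 hyp3.
rewrite /l !add0r mul0r subr0 /v g0 addr0.
rewrite {2}/a powRM ?powR_ge0// KpE -(powRrM beta).
rewrite (_ : p / 2 * (2 / p) = 1); last by field; rewrite gt_eqF.
rewrite powRr1 ?(ltW beta0)// => le1.
have {le1} : (a + g t) `^ (2 / p) <= K `^ 2 * (beta + t * b) by lra.
have ut0 : 0 < a + g t by rewrite u0// in_itv/= t0 lexx.
have bt0 : 0 <= beta + t * b by rewrite addr_ge0 ?mulr_ge0 ?(ltW beta0) ?(ltW b0).
have q0 : 0 <= p / 2 by rewrite divr_ge0// ltW.
move=> /(ge0_ler_powR q0); rewrite !nnegrE powR_ge0 mulr_ge0 ?powR_ge0//.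
move=> /(_ isT isT); rewrite -powRrM (_ : 2 / p * (p / 2) = 1); last first.
  by field; rewrite gt_eqF.
rewrite powRr1 ?(ltW ut0)// powRM ?powR_ge0// -powRrM.
by rewrite (mulrC 2) divfK.
Qed.

(** * The bound in expectation *)

Lemma Rintegral_sum {d} {T : measurableType d} {R : realType}
    (mu : {measure set T -> \bar R}) (A : set T) (s : seq nat) (f : nat -> T -> R) :
  measurable A -> (forall i, i \in s -> mu.-integrable A (EFin \o f i)) ->
  mu.-integrable A (EFin \o (fun w => \sum_(i <- s) f i w)) /\
  \int[mu]_(w in A) (\sum_(i <- s) f i w) = \sum_(i <- s) \int[mu]_(w in A) f i w.
Proof.
move=> mA; elim: s => [_|i s IH intf].
  rewrite big_nil; have -> : (fun w : T => \sum_(i <- [::]) f i w) = cst 0.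
    by apply/funext => w; rewrite big_nil.
  by split; [exact: integrable0|rewrite Rintegral_cst// mul0r].
have [j js|is_ es] := IH.
  by apply: intf; rewrite inE js orbT.
have fi := intf i (mem_head _ _).
have -> : (fun w : T => \sum_(j <- i :: s) f j w) =
    (fun w => f i w + \sum_(j <- s) f j w).
  by apply/funext => w; rewrite big_cons.
split; first exact: (integrableD mA fi is_).
by rewrite RintegralD// es big_cons.
Qed.

Section conditional_moment.
Context {R : realType} {B : normedModType R} {p C K : R}.
Context {d : measure_display} {T : measurableType d} {P : probability T R}.
Context {X : nat -> T -> B} {F : nat -> set (set T)} {Y : nat -> nat -> T -> B}.
Context {n : nat} {D2 : B -> B -> B -> R}.
Hypotheses (p2 : 2 <= p) (K0 : 0 < K) (CE : C = K `^ 2 * (p / 2)).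
Hypothesis sB : separable_space B.
Hypothesis psi_D2 : twice_diff_with (@psi_p R B p) D2.
Hypothesis D2_le : forall x u v : B,
  `|D2 x u v| <= C * `|x| `^ (p - 2) * `|u| * `|v|.
Hypothesis filtF : filtration F.
Hypothesis mX : forall i, (1 <= i)%N -> G_measurable (F i) (X i).
Hypothesis iX : forall i, (1 <= i)%N ->
  P.-integrable setT (fun w => (`|X i w| `^ p)%:E).
Hypothesis ceY : forall i k, (1 <= i)%N -> (i <= k <= n)%N ->
  is_cond_expB P (F i) (X k) (Y i k).
Hypothesis iXY : forall i l, (1 <= i)%N -> (i <= l <= n)%N ->
  P.-integrable setT (fun w =>
    (`|X i w| `^ (p / 2) * `|\sum_(i <= k < l.+1) Y i k w| `^ (p / 2))%:E).
Context {A : set T} {b : nat -> R} {eta : R}.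
Hypothesis FA : F 0%N A.
Hypothesis b0 : forall i, 0 < b i.
Hypothesis eta0 : 0 < eta.
Hypothesis XY_le : forall i l, (1 <= i)%N -> (i <= l <= n)%N ->
  \int[P]_(w in A)
    (`|X i w| `^ (p / 2) * `|\sum_(i <= k < l.+1) Y i k w| `^ (p / 2))
  <= b i `^ (p / 2).

Local Notation D := (@dpsi R B p).
Let p0 : 0 < p. Proof. exact: lt_le_trans p2. Qed.

Let C0 : 0 <= C.
Proof. by rewrite CE mulr_ge0 ?powR_ge0// divr_ge0// ltW. Qed.

Let S m w := \sum_(1 <= i < m.+1) X i w.
(** The positive [eta] makes [beta] positive already at index 0, so that its powers can be
    differentiated. *)
Let beta m := eta + \sum_(1 <= i < m.+1) b i.
Let VX k l w := \sum_(k.+1 <= i < l.+1) X i w.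
(** All terms are conditioned at time [k.+1], when [S k] and [X k.+1] are known; this is the sum
    that [XY_le] controls by [b k.+1]. *)
Let VY k l w := \sum_(k.+1 <= i < l.+1) Y k.+1 i w.

Let SS m w : S m.+1 w = S m w + X m.+1 w.
Proof. by rewrite /S big_nat_recr. Qed.

Let betaS m : beta m.+1 = beta m + b m.+1.
Proof. by rewrite /beta big_nat_recr//= addrA. Qed.

Let beta_gt0 m : 0 < beta m.
Proof. by rewrite /beta ltr_wpDr// sumr_ge0// => i _; exact: ltW. Qed.

Let SB k l w : (k <= l)%N -> S l w - S k w = VX k l w.
Proof. by move=> kl; rewrite /S (@big_cat_nat _ _ _ k.+1)//= addrAC subrr add0r. Qed.

Let sF i : sigma_algebra setT (F i).
Proof. by have [] := filtF i. Qed.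

Let Fm i : F i `<=` measurable.
Proof. by have [] := filtF i. Qed.

Let FS i j : (i <= j)%N -> F i `<=` F j.
Proof.
elim: j => [|j IH]; first by rewrite leqn0 => /eqP->.
rewrite leq_eqVlt => /predU1P[->//|/IH Fij].
by apply: (subset_trans Fij); have [] := filtF j.
Qed.

Let mA : measurable A. Proof. exact: Fm FA. Qed.

Let mFX i j : (1 <= i <= j)%N -> G_measurable (F j) (X i).
Proof. by move=> /andP[i1 ij] O oO; apply: (FS ij); exact: mX. Qed.

Let mFS m j : (m <= j)%N -> G_measurable (F j) (S m).
Proof.
move=> mj; apply: G_measurable_sum => // i; rewrite mem_index_iota ltnS.
by move=> /andP[i1 im]; apply: mFX; rewrite i1 (leq_trans im).
Qed.

Let mFm j (U : T -> B) : G_measurable (F j) U -> G_measurable measurable U.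
Proof. by move=> mU O oO; apply: (@Fm j); exact: mU. Qed.

Let mS m : G_measurable measurable (S m).
Proof. by apply: mFm; exact: (mFS (leqnn m)). Qed.

Let mXm i : (1 <= i)%N -> G_measurable measurable (X i).
Proof. by move=> i1; apply: mFm; exact: mX. Qed.

Let mVX k l : G_measurable measurable (VX k l).
Proof.
apply: (G_measurable_sum (@sigma_algebra_measurable _ _)) => // i.
rewrite mem_index_iota => /andP[ki _]; apply: mXm.
exact: leq_trans ki.
Qed.

Let mVY k l : (l <= n)%N -> G_measurable measurable (VY k l).
Proof.
move=> ln; apply: (G_measurable_sum (@sigma_algebra_measurable _ _)) => // i.
rewrite mem_index_iota => /andP[ki il].
have [//||_ _ mY _ _] := @ceY k.+1 i; first by rewrite ki (leq_trans _ ln).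
exact: mFm mY.
Qed.

Let iXA i : (1 <= i)%N -> P.-integrable A (fun w => (`|X i w| `^ p)%:E).
Proof. by move=> i1; apply: integrableS (iX i1). Qed.

Let iVX k l : P.-integrable A (fun w => (`|VX k l w| `^ p)%:E).
Proof.
have [lk|kl] := ltnP l k.+1.
  have -> : (fun w => (`|VX k l w| `^ p)%:E) = (fun=> 0%E).
    by apply/funext => w; rewrite /VX big_geq// normr0 powR0// gt_eqF.
  exact: integrable0.
elim: l kl => // l IH; rewrite ltnS leq_eqVlt => /predU1P[<-|kl].
  have -> : (fun w => (`|VX k k.+1 w| `^ p)%:E) = (fun w => (`|X k.+1 w| `^ p)%:E).
    by apply/funext => w; rewrite /VX big_nat1.
  exact: iXA.
have -> : (fun w => (`|VX k l.+1 w| `^ p)%:E) =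
    (fun w => (`|VX k l w + 1 *: X l.+1 w| `^ p)%:E).
  by apply/funext => w; rewrite /VX big_nat_recr ?scale1r// ltnW.
exact: (integrable_powR_addZ p2 sB mA 1 (mVX _ _) (mXm _) (IH kl) (iXA _)).
Qed.

Let iS m : P.-integrable A (fun w => (`|S m w| `^ p)%:E).
Proof. exact: (iVX 0%N m). Qed.

Let iXVX k l : P.-integrable A
  (fun w => (`|X k.+1 w| `^ (p / 2) * `|VX k l w| `^ (p / 2))%:E).
Proof.
have ig := integrableD mA (iXA (ltn0Sn k)) (iVX k l).
apply: (le_integrable mA _ _ ig).
- by apply/measurable_EFinP; apply: measurable_funM;
    apply: measurable_norm_powR => //; exact: mXm.
- move=> w _; rewrite -EFinD !abse_EFin lee_fin.
  rewrite !ger0_norm ?addr_ge0 ?mulr_ge0 ?powR_ge0//.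
  have sq x : 0 <= x -> x `^ p = (x `^ (p / 2)) ^+ 2 :> R.
    by move=> x0; rewrite -powR_mulrn ?powR_ge0// -powRrM divfK.
  rewrite !sq//; set x := _ `^ _; set y := _ `^ _.
  have := sqr_ge0 (x - y); have := sqr_ge0 x; have := sqr_ge0 y.
  by rewrite sqrrB -mulr_natr; lra.
Qed.

Let iXVY k l : (l <= n)%N -> P.-integrable A
  (fun w => (`|X k.+1 w| `^ (p / 2) * `|VY k l w| `^ (p / 2))%:E).
Proof.
move=> ln; have [lk|kl] := ltnP l k.+1.
  rewrite [X in P.-integrable _ X](_ : _ = (fun=> 0%E)); first exact: integrable0.
  by apply/funext => w; rewrite /VY big_geq// normr0 powR0 ?mulr0// gt_eqF// divr_gt0.
by apply: integrableS (iXY (ltn0Sn k) _) => //; rewrite kl.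
Qed.

Let L k s (V : T -> B) w := D (S k w + s *: X k.+1 w) (V w) - D (S k w) (V w).

Let iLX k l s : `|s| <= 2 -> P.-integrable A (EFin \o L k s (VX k l)).
Proof.
move=> s2; exact: (integrable_dpsi_diff p2 C0 sB psi_D2 D2_le mA (mS k)
  (mXm (ltn0Sn k)) (mVX k l) (iS k) (iXA (ltn0Sn k)) (iXVX k l) s2).
Qed.

Let iLY k l s : (l <= n)%N -> `|s| <= 2 -> P.-integrable A (EFin \o L k s (VY k l)).
Proof.
move=> ln s2; exact: (integrable_dpsi_diff p2 C0 sB psi_D2 D2_le mA (mS k)
  (mXm (ltn0Sn k)) (mVY k ln) (iS k) (iXA (ltn0Sn k)) (iXVY k ln) s2).
Qed.

Let LD k s V V' w : L k s (fun w => V w + V' w) w = L k s V w + L k s V' w.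
Proof. by rewrite /L !diff_psiD; ring. Qed.

Let L0 k s V w : V w = 0 -> L k s V w = 0.
Proof. by rewrite /L => ->; rewrite -(subrr 0) !diff_psiB !subrr. Qed.

(* The gradients entering [L k s] only depend on the past up to time [k + 1],
   so the future increments may be replaced by their conditional expectations. *)
Let flow_pairing k l s : (k <= l <= n)%N -> `|s| <= 2 ->
  \int[P]_(w in A) L k s (VX k l) w = \int[P]_(w in A) L k s (VY k l) w.
Proof.
move=> + s2; elim: l => [|l IH] /andP[kl ln].
  move: kl; rewrite leqn0 => /eqP ->.
  by apply: eq_Rintegral => w _; rewrite !L0// /VX /VY big_geq.
move: kl; rewrite leq_eqVlt => /predU1P[->|]; last rewrite ltnS => kl.
  by apply: eq_Rintegral => w _; rewrite !L0// /VX /VY big_geq.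
have {}IH := IH (introT andP (conj kl (ltnW ln))).
have VXS : VX k l.+1 = (fun w => VX k l w + X l.+1 w).
  by apply/funext => w; rewrite /VX big_nat_recr.
have VYS : VY k l.+1 = (fun w => VY k l w + Y k.+1 l.+1 w).
  by apply/funext => w; rewrite /VY big_nat_recr.
(* Integrability is at hand for partial sums only, so that of a single term is obtained from two
   consecutive sums. *)
have LX w : L k s (X l.+1) w = L k s (VX k l.+1) w - L k s (VX k l) w.
  by rewrite VXS LD addrC addKr.
have LY w : L k s (Y k.+1 l.+1) w = L k s (VY k l.+1) w - L k s (VY k l) w.
  by rewrite VYS LD addrC addKr.
have iX1 : P.-integrable A (EFin \o L k s (X l.+1)).
  rewrite (_ : L k s (X l.+1) = fun w => L k s (VX k l.+1) w - L k s (VX k l) w).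
    exact: (integrableB mA (iLX k l.+1 s2) (iLX k l s2)).
  exact/funext.
have iY1 : P.-integrable A (EFin \o L k s (Y k.+1 l.+1)).
  rewrite (_ : L k s (Y k.+1 l.+1) =
    fun w => L k s (VY k l.+1) w - L k s (VY k l) w).
    exact: (integrableB mA (iLY k ln s2) (iLY k (ltnW ln) s2)).
  exact/funext.
have -> : \int[P]_(w in A) L k s (VX k l.+1) w =
    \int[P]_(w in A) L k s (VX k l) w + \int[P]_(w in A) L k s (X l.+1) w.
  rewrite -RintegralD//; last exact: iLX.
  by apply: eq_Rintegral => w _; rewrite VXS LD.
have -> : \int[P]_(w in A) L k s (VY k l.+1) w =
    \int[P]_(w in A) L k s (VY k l) w + \int[P]_(w in A) L k s (Y k.+1 l.+1) w.
  rewrite -RintegralD//; last exact: (iLY k (ltnW ln)).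
  by apply: eq_Rintegral => w _; rewrite VYS LD.
congr (_ + _); first exact: IH.
have [//||mX1 iX1' mY1 iY1' XYE] := @ceY k.+1 l.+1; first by rewrite ltnS kl.
apply: (integral_dpsi_diff_eq p2 C0 sB psi_D2 D2_le (sF k.+1) (@Fm k.+1) mX1
  (mFm mY1) iX1' iY1') => //.
- by move=> f cf A' GA'; rewrite XYE.
- apply: G_measurable_addZ => //; first exact: mFS.
  exact: mX.
- exact: mFS.
- exact: (FS (leq0n _)).
Qed.

Let g k l s := \int[P]_(w in A) L k s (VY k l) w.

Let dg k l s := \int[P]_(w in A) D2 (S k w + s *: X k.+1 w) (X k.+1 w) (VY k l w).

Let g_drv k l (s : R) : (l <= n)%N -> `|s| < 2 -> is_derive s 1 (g k l) (dg k l s).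
Proof.
move=> ln s2; exact: (integral_dpsi_diff_is_derive p2 C0 sB psi_D2 D2_le mA (mS k)
  (mXm (ltn0Sn k)) (mVY k ln) (iS k) (iXA (ltn0Sn k)) (iXVY k ln) s2).
Qed.

Let dg_le k l (s H : R) : (k < l <= n)%N -> `|s| <= 2 -> 0 < H ->
  \int[P]_(w in A) (`|S k w + s *: X k.+1 w| `^ p) <= H ->
  dg k l s <= C * (H `^ (1 - 2 / p) * b k.+1).
Proof.
move=> kln s2 H0 SH; have /andP[kl ln] := kln.
apply: (integral_D2_le p2 C0 sB psi_D2 D2_le mA (mS k)
  (mXm (ltn0Sn k)) (mVY k ln) (iS k) (iXA (ltn0Sn k)) (iXVY k ln) H0 (b0 _) s2 SH).
exact: XY_le.
Qed.

Let g0 k l : g k l 0 = 0.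
Proof.
rewrite /g (_ : (fun w => _) = cst 0) ?Rintegral_cst ?mul0r//.
by apply/funext => w; rewrite /L scale0r addr0 subrr.
Qed.

Let bound k s := 
  \int[P]_(w in A) (`|S k w + s *: X k.+1 w| `^ p)
    <= K `^ p * (beta k + s * b k.+1) `^ (p / 2).

(** The moment bounds at step [k], inserted in [dg_le], give the hypothesis of [sharp_flow_bound].
    The result does not depend on the horizon [l] and telescopes in [k]. *)
Let g1_le k l : (k < l <= n)%N -> (forall s : R, 0 <= s <= 1 -> bound k s) ->
  g k l 1 <= K `^ p * beta k.+1 `^ (p / 2) - K `^ p * beta k `^ (p / 2).
Proof.
move=> kln bk; have /andP[kl ln] := kln.
have := @sharp_flow_bound R p C K (b k.+1) (beta k) (g k l) (dg k l) p2 K0 CE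
  (b0 _) (beta_gt0 _).
rewrite g0 subr0 -betaS; apply.
- move=> s; rewrite in_itv/= => /andP[s0 s1]; apply: g_drv => //.
  by rewrite ger0_norm// (le_lt_trans s1)// ltr1n.
- move=> s; rewrite in_itv/= => /andP[s0 s1]; apply: dg_le => //.
  + by rewrite ger0_norm ?(ltW s0)// (le_trans (ltW s1))// ler1n.
  + by rewrite mulr_gt0 ?powR_gt0// addr_gt0// mulr_gt0.
  + by apply: bk; rewrite (ltW s0) (ltW s1).
Qed.

(** With horizon [k.+1] the pairing leads back to [X k.+1] itself; monotonicity of the gradient
    along [s *: X k.+1], divided by [s], gives the sign. *)
Let g_ge0 k s : (k < n)%N -> 0 <= s <= 1 -> 0 <= g k k.+1 s.
Proof.
move=> kn /andP[s0 s1]; rewrite /g -flow_pairing ?leqnSn//; last first.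
  by rewrite ger0_norm// (le_trans s1)// ler1n.
apply: Rintegral_ge0 => w _; rewrite /L /VX big_nat1 subr_ge0.
move: s0; rewrite le_eqVlt => /predU1P[<-|s0]; first by rewrite scale0r addr0.
have := diff_psi_mono p2 psi_D2 (S k w) (s *: X k.+1 w).
by rewrite !diff_psiZ ler_pM2l.
Qed.

Let path_bound m s : (m < n)%N -> 0 <= s <= 1 ->
  (forall k, (k < m)%N -> forall s : R, 0 <= s <= 1 -> bound k s) ->
  \int[P]_(w in A) (`|S m w + s *: X m.+1 w| `^ p) <=
  K `^ p * beta m `^ (p / 2) + g m m.+1 s.
Proof.
move=> mn s01 IH; have /andP[s0 s1] := s01.
have s2 : `|s| <= 2 by rewrite ger0_norm// (le_trans s1)// ler1n.
have one2 : `|1| <= 2 :> R by rewrite normr1 ler1n.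
(* The increment from [S k] to the end point is a convex combination of [VX k m] and [VX k m.+1], so
   both horizons occur. *)
pose f k w := (1 - s) * L k 1 (VX k m) w + s * L k 1 (VX k m.+1) w.
have iZ a h : P.-integrable A (EFin \o h) -> P.-integrable A (EFin \o (fun w => a * h w)).
  by move=> ih; exact: (integrableZl mA a ih).
have i_f k : P.-integrable A (EFin \o f k).
  by apply: (integrableD mA (iZ _ _ (iLX _ _ one2)) (iZ _ _ (iLX _ _ one2))).
have [isum Esum] := @Rintegral_sum _ _ _ P A (index_iota 0 m) f mA (fun k _ => i_f k).
have ilast := iZ s _ (iLX m m.+1 s2).
apply: (@le_trans _ _ (\int[P]_(w in A) (\sum_(0 <= k < m) f k w +
    s * L m s (VX m m.+1) w))).
  apply: le_Rintegral => //.
  - exact: (integrable_powR_addZ p2 sB mA s (mS m) (mXm _) (iS m) (iXA _)).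
  - exact: (integrableD mA isum ilast).
  move=> w _.
  (* The path [S 0, ..., S m], followed at index [m.+1] by the end point. *)
  pose sk k := if (k <= m)%N then S k w else S m w + s *: X m.+1 w.
  have sk0 : sk 0%N = 0 by rewrite /sk/= /S big_geq.
  have := psi_path_le p2 psi_D2 m.+1 sk0.
  rewrite big_nat_recr//= /sk ltnn leqnn /psi_p => /le_trans; apply.
  rewrite lerD//; last first.
    rewrite (addrC (S m w)) addrK !diff_psiZ /L /VX big_nat1 addrC.
    by rewrite mulrBr.
  rewrite big_nat [leRHS]big_nat; apply: ler_sum => k /= km.
  rewrite km (ltnW km).
  have -> : S m w + s *: X m.+1 w - S k w =
      (1 - s) *: VX k m w + s *: VX k m.+1 w.
    rewrite -!SB ?(ltnW km)//; last exact: leq_trans (ltnW km) _.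
    by rewrite SS (addrAC (S m w) (X m.+1 w)) (scalerDr s) addrA -scalerDl subrK scale1r addrAC.
  rewrite !diff_psiD !diff_psiZ /f /L scale1r -SS.
  by rewrite le_eqVlt; apply/orP; left; apply/eqP; ring.
rewrite RintegralD// Esum RintegralZl//; last exact: iLX.
rewrite -/(L m s (VX m m.+1)) lerD//; last first.
  rewrite flow_pairing ?leqnSn//.
  by rewrite -/(g m m.+1 s) ler_piMl// g_ge0.
apply: (@le_trans _ _ (\sum_(0 <= k < m)
   (K `^ p * beta k.+1 `^ (p / 2) - K `^ p * beta k `^ (p / 2)))); last first.
  rewrite (telescope_sumr (fun k => K `^ p * beta k `^ (p / 2)))//.
  by rewrite lerBlDr lerDl mulr_ge0 ?powR_ge0.
rewrite big_nat [leRHS]big_nat; apply: ler_sum => k /= km.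
rewrite /f RintegralD ?RintegralZl//; try exact: iZ (iLX _ _ one2).
all: try exact: iLX.
rewrite !flow_pairing ?(ltnW km) ?(ltnW mn)//; last first.
  by rewrite mn andbT (leq_trans (ltnW km)).
rewrite -/(g k m 1) -/(g k m.+1 1).
have le1 : g k m 1 <= K `^ p * beta k.+1 `^ (p / 2) - K `^ p * beta k `^ (p / 2).
  by apply: g1_le; [rewrite km ltnW|exact: IH].
have le2 : g k m.+1 1 <= K `^ p * beta k.+1 `^ (p / 2) - K `^ p * beta k `^ (p / 2).
  by apply: g1_le; [rewrite mn andbT (leq_trans km)|exact: IH].
have := ler_wpM2l s0 le2.
have s1' : 0 <= 1 - s by rewrite subr_ge0.
have := ler_wpM2l s1' le1.
by lra.
Qed.

(** Strong induction on [m]: the bounds for smaller indices give [path_bound], whose right-hand side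
    serves as [H] in [dg_le]. The derivative of [g m m.+1] is thus bounded in terms of [g m m.+1]
    itself. *)
Lemma moment_flow_bound m t : (m < n)%N -> 0 <= t <= 1 ->
  \int[P]_(w in A) (`|\sum_(1 <= i < m.+1) X i w + t *: X m.+1 w| `^ p)
    <= K `^ p * (eta + \sum_(1 <= i < m.+1) b i + t * b m.+1) `^ (p / 2).
Proof.
elim/ltn_ind: m t => m IH t mn t01; have /andP[t0 t1] := t01.
have pb (s : R) : 0 <= s <= 1 -> \int[P]_(w in A) (`|S m w + s *: X m.+1 w| `^ p) <=
    K `^ p * beta m `^ (p / 2) + g m m.+1 s.
  move=> s01; apply: path_bound => // k km s' s01'.
  by apply: IH => //; exact: ltn_trans mn.
apply: (le_trans (pb t t01)).
have sub01 (s : R) : s \in `[0, t]%R -> 0 <= s <= 1.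
  by rewrite in_itv/= => /andP[-> /le_trans->].
apply: (bihari_flow_bound (dg := dg m m.+1) p2 K0 CE (b0 m.+1) (beta_gt0 m)) => //.
- by move=> s /sub01 s01; exact: g_ge0.
- move=> s /sub01 /andP[s0 s1]; apply: g_drv => //.
  by rewrite ger0_norm// (le_lt_trans s1)// ltr1n.
- move=> s st; have s01 : 0 <= s <= 1.
    by apply: sub01; move: st; rewrite !in_itv/= => /andP[/ltW-> /ltW->].
  have /andP[s0 s1] := s01.
  apply: dg_le; first by rewrite ltnSn.
  + by rewrite ger0_norm// (le_trans s1)// ler1n.
  + by rewrite ltr_wpDr ?g_ge0// mulr_gt0 ?powR_gt0.
  + exact: pb.
Qed.

Lemma moment_bound :
  \int[P]_(w in A) (`|\sum_(1 <= i < n.+1) X i w| `^ p)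
    <= K `^ p * (eta + \sum_(1 <= i < n.+1) b i) `^ (p / 2).
Proof.
have [n0|n1] := posnP n.
  rewrite (_ : (fun w => _) = cst 0) ?Rintegral_cst ?mul0r//.
    by rewrite mulr_ge0 ?powR_ge0.
  by apply/funext => w; rewrite n0 big_geq// normr0 powR0// gt_eqF.
have m1 : (n.-1 < n)%N by rewrite prednK.
have := moment_flow_bound m1 (t := 1); rewrite ler01 lexx mul1r => /(_ isT).
rewrite prednK// [in X in _ -> _ <= X]big_nat_recr ?addrA//=.
have -> : (fun w => `|\sum_(1 <= i < n) X i w + 1 *: X n w| `^ p) =
    (fun w => `|\sum_(1 <= i < n.+1) X i w| `^ p).
  by apply/funext => w; rewrite [in RHS]big_nat_recr// scale1r.
exact.
Qed.

End conditional_moment.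

(** * From expectations to the almost sure bound *)

(** The integral of [|f|] over [A] vanishes, so [f] is zero almost everywhere on [A], against its
    strict positivity. *)
Lemma Rintegral_le0_null {d} {T : measurableType d} {R : realType}
    (mu : {measure set T -> \bar R}) (A : set T) (f : T -> R) :
  measurable A -> mu.-integrable A (EFin \o f) -> (forall x, A x -> 0 < f x) ->
  \int[mu]_(x in A) f x <= 0 -> mu A = 0%E.
Proof.
move=> mA intf f_gt0 int_le0.
have mf : measurable_fun A (EFin \o f) by case/integrableP: intf.
have int0 : (\int[mu]_(x in A) (f x)%:E = 0)%E.
  have ge0 : (0 <= \int[mu]_(x in A) (f x)%:E)%E.
    by apply: integral_ge0 => x Ax; rewrite lee_fin ltW// f_gt0.
  apply/eqP; rewrite eq_le ge0 andbT -[leLHS]fineK ?lee_fin//.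
  exact: integrable_fin_num.
have /(ae_eq_integral_abs mu mA mf) [N [mN N0 AN]] :
    (\int[mu]_(x in A) `|(EFin \o f) x| = 0)%E.
  rewrite -int0; apply: eq_integral => x; rewrite inE => Ax /=.
  by rewrite ger0_norm// ltW// f_gt0.
apply: (subset_measure0 mA mN _ N0) => x Ax; apply: AN => /= /(_ Ax) [fx0].
by have := f_gt0 _ Ax; rewrite fx0 ltxx.
Qed.

(** Provides strict rational bounds, of which there are countably many choices. Entry 0 will serve
    as [eta], the others as strict upper bounds of [beta i]. *)
Lemma rational_slack {R : realType} (p k w : R) (n : nat) (beta : nat -> R) :
  0 < p -> 0 < k -> (forall i, 0 <= beta i) ->
  k * (\sum_(1 <= i < n.+1) beta i) `^ (p / 2) < w ->
  exists r : seq rat,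
    [/\ forall i, (i <= n)%N -> 0 < ratr r`_i :> R,
        forall i, (1 <= i <= n)%N -> beta i < ratr r`_i &
        k * (\sum_(0 <= i < n.+1) ratr r`_i) `^ (p / 2) < w].
Proof.
move=> p0 k0 beta0 ltw; set s := \sum_(1 <= i < n.+1) beta i in ltw.
have s0 : 0 <= s by apply: sumr_ge0 => i _.
have q0 : 0 < p / 2 by rewrite divr_gt0.
have q1 : 0 < 2 / p by rewrite divr_gt0.
have pq : p / 2 * (2 / p) = 1 by field; rewrite gt_eqF.
have w0 : 0 < w by apply: le_lt_trans ltw; rewrite mulr_ge0 ?powR_ge0// ltW.
(* The solution of [k * v^(p/2) = w]; the gap [v - s] is shared equally among the [n + 1]
   entries. *)
pose v := (w / k) `^ (2 / p).
have sv : s < v.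
  rewrite -(powRr1 s0) -pq powRrM; apply: gt0_ltr_powR => //.
  - by rewrite nnegrE powR_ge0.
  - by rewrite nnegrE divr_ge0// ltW.
  - by rewrite ltr_pdivlMr// mulrC.
have vE : k * v `^ (p / 2) = w.
  by rewrite -powRrM (mulrC (2 / p)) pq powRr1 ?divr_ge0 ?ltW// mulrC divfK ?gt_eqF.
pose e := (v - s) / n.+1%:R.
have e0 : 0 < e by rewrite divr_gt0 ?subr_gt0 ?ltr0n.
pose beta' i := if i is 0%N then 0 else beta i.
have /choice[f fP] : forall i, exists r : rat, beta' i < ratr r < beta' i + e.
  by move=> i; have [] := @rat_in_itvoo R (beta' i) (beta' i + e);
     rewrite ?ltrDl// => r; rewrite in_itv/=; exists r.
have beta'0 i : 0 <= beta' i by case: i => [|i] /=.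
have rE i : (i <= n)%N -> (mkseq f n.+1)`_i = f i by move=> ? ; rewrite nth_mkseq.
exists (mkseq f n.+1); split.
- move=> i ni; rewrite rE//; have /andP[+ _] := fP i.
  exact: le_lt_trans.
- by move=> [//|i] /andP[_ ni]; rewrite rE//; have /andP[] := fP i.+1.
rewrite -[ltRHS]vE ltr_pM2l//.
have sumE : \sum_(0 <= i < n.+1) (beta' i + e) = v.
  rewrite big_split/= big_ltn// add0r big_nat.
  rewrite (eq_bigr beta); last by move=> [//|i] _.
  by rewrite -big_nat -/s sumr_const_nat subn0 -mulr_natr divfK ?subrKC//.
apply: gt0_ltr_powR => //.
- by rewrite nnegrE big_nat sumr_ge0// => i /= ni; rewrite rE//; 
    have /andP[/ltW + _] := fP i; apply: le_trans.
- by rewrite nnegrE (le_trans s0)// ltW.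
rewrite -sumE; apply: ltr_sum_nat => // i /= ni.
by rewrite rE//; have /andP[] := fP i.
Qed.

Theorem theorem2p1 (R : realType) (B : completeNormedModType R) (p c : R)
  (d : measure_display) (T : measurableType d) (P : probability T R)
  (X : nat -> T -> B) (F : nat -> set (set T))
  (Y : nat -> nat -> T -> B) (Z : nat -> nat -> T -> R) (W : T -> R)
  (n : nat) :
  2 <= p ->
  separable_space B ->
  class_C2tilde B p c ->
  filtration F ->
  (forall i, (1 <= i)%N -> G_measurable (F i) (X i)) ->
  (forall i, (1 <= i)%N -> centeredB P (X i)) ->
  (forall i, (1 <= i)%N -> (\int[P]_x (`|X i x| `^ p)%:E < +oo)%E) ->
  (* Y i k is a version of E_i(X_k) *)
  (forall i k, (1 <= i)%N -> (i <= k <= n)%N ->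
     is_cond_expB P (F i) (X k) (Y i k)) ->
  (* Z i l is a version of E_0(|X_i|^(p/2) |sum_{k=i}^l E_i(X_k)|^(p/2)) *)
  (forall i l, (1 <= i)%N -> (i <= l <= n)%N ->
     is_cond_exp P (F 0%N)
       (fun x => `|X i x| `^ (p / 2) * `|\sum_(i <= k < l.+1) Y i k x| `^ (p / 2))
       (Z i l)) ->
  (* W is a version of E_0(|S_n|^p) *)
  is_cond_exp P (F 0%N) (fun x => `|\sum_(1 <= i < n.+1) X i x| `^ p) W ->
  {ae P, forall x,
    W x <= (Num.sqrt (2 / p) * Num.sqrt (Num.max c (p / 2))) `^ p *
      (\sum_(1 <= i < n.+1)
         \big[Num.max/0]_(i <= l < n.+1) (Z i l x `^ (2 / p))) `^ (p / 2)}.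
Proof.
move=> p2 sB [D2 [psi_D2 D2_lec]] filtF mX _ pX ceY ceZ ceW.
have p0 : 0 < p by exact: lt_le_trans p2.
set C := Num.max c (p / 2); set K := Num.sqrt (2 / p) * Num.sqrt C.
have C0 : 0 < C by rewrite lt_max divr_gt0 ?orbT.
have K0 : 0 < K by rewrite mulr_gt0 ?sqrtr_gt0 ?divr_gt0.
(* This relation between the constants is what both flow bounds require. *)
have CE : C = K `^ 2 * (p / 2).
  rewrite powR_mulrn ?(ltW K0)// exprMn !sqr_sqrtr ?(ltW C0) ?divr_ge0 ?(ltW p0)//.
  by field; rewrite gt_eqF.
have D2_le x u v : `|D2 x u v| <= C * `|x| `^ (p - 2) * `|u| * `|v|.
  rewrite (le_trans (D2_lec x u v))// ler_wpM2r// ler_wpM2r//.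
  by rewrite ler_wpM2r ?powR_ge0// le_max lexx.
have sF i : sigma_algebra setT (F i) by have [] := filtF i.
have Fm i : F i `<=` measurable by have [] := filtF i.
have iX i : (1 <= i)%N -> P.-integrable setT (fun w => (`|X i w| `^ p)%:E).
  move=> i1; apply/integrableP; split.
    apply/measurable_EFinP; apply: measurable_norm_powR => //.
    by move=> O oO; apply: (@Fm i); exact: mX.
  apply: le_lt_trans (pX i i1); rewrite le_eqVlt; apply/orP; left; apply/eqP.
  by apply: eq_integral => w _ /=; rewrite ger0_norm// powR_ge0.
have Kp0 : 0 < K `^ p by rewrite powR_gt0.
(* [k] codes a finite sequence of rationals; numbers that code none, and indices past the end, give
   0. *)
pose r k i : R := ratr (odflt [::] (unpickle k : option (seq rat)))`_i.
pose kappa k := K `^ p * (\sum_(0 <= i < n.+1) r k i) `^ (p / 2).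
pose N k := [set x | kappa k < W x /\
  forall i l, (1 <= i)%N -> (i <= l <= n)%N -> Z i l x < r k i `^ (p / 2)].
(* Codes with a nonpositive entry up to index [n] are discarded, since [moment_bound] takes positive
   bounds. *)
pose N' k := if `[< forall i, (i <= n)%N -> 0 < r k i >] then N k else set0.
have [_ mW iW WE] := ceW.
suff N0 k : P.-negligible (N' k).
  apply: (@negligibleS _ _ _ P (\bigcup_k N' k)); last exact: negligible_bigcup.
  move=> x /= /negP; rewrite -ltNge => RHS_lt.
  pose be i := \big[Num.max/0]_(i <= l < n.+1) (Z i l x `^ (2 / p)).
  have be0 i : 0 <= be i by rewrite /be; apply: bigmax_ge_id.
  have [q [q1 q2 q3]] := rational_slack p0 Kp0 be0 RHS_lt.
  exists (pickle q) => //; rewrite /N'; case: asboolP => [_|]; last first.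
    by case=> i ni; rewrite /r pickleK; exact: q1.
  split; first by rewrite /kappa /r pickleK.
  move=> i l i1 /andP[il ln]; rewrite /r pickleK/=.
  have ri0 : 0 < ratr q`_i :> R by apply: q1; exact: leq_trans ln.
  (* At points where [Z i l] is negative the powers [2 / p] and [p / 2] need not cancel, but the
     bound is immediate. *)
  have [Z0|Z0] := ltP (Z i l x) 0; first by rewrite (lt_trans Z0)// powR_gt0.
  have -> : Z i l x = (Z i l x `^ (2 / p)) `^ (p / 2).
    rewrite -powRrM (_ : 2 / p * (p / 2) = 1) ?powRr1//.
    by field; rewrite gt_eqF.
  apply: gt0_ltr_powR; rewrite ?nnegrE ?powR_ge0 ?divr_gt0//.
    exact: ltW.
  apply: le_lt_trans (q2 i _); last by rewrite i1 (leq_trans il ln).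
  apply: (@le_bigmax_seq _ _ _ _ _ _ xpredT (fun l => Z i l x `^ (2 / p))) => //.
  by rewrite mem_index_iota il ltnS.
rewrite /N'; case: asboolP => [r0|_]; last exact: negligible_set0.
have FN : F 0%N (N k).
  (* The whole space outside the relevant range, so that the event becomes an intersection over all
     [i] and [l]. *)
  pose M i l := if ((1 <= i) && (i <= l <= n))%N then
    [set x | Z i l x < r k i `^ (p / 2)] else setT.
  have -> : N k = [set x | kappa k < W x] `&` \bigcap_i \bigcap_l M i l.
    apply/seteqP; split => x.
      move=> [kW ZM]; split => // i _ l _; rewrite /M; case: ifP => //.
      by move=> /andP[i1 il]; exact: ZM.
    move=> [kW ZM]; split => // i l i1 il.
    by have := ZM i I l I; rewrite /M i1 il.
  apply/(sigma_algebra_measurableE (sF 0%N)); apply: measurableI.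
    by apply/(sigma_algebra_measurableE (sF 0%N)); exact: G_measurable_gt.
  apply: bigcapT_measurable => i; apply: bigcapT_measurable => l.
  rewrite /M; case: ifP => [/andP[i1 il]|_]; last exact: measurableT.
  apply/(sigma_algebra_measurableE (sF 0%N)); apply: G_measurable_lt.
  by have [] := ceZ i l i1 il.
have mN := Fm _ _ FN.
have [PN0|PN0] := eqVneq (P (N k)) 0%E; first exact/negligibleP.
pose a := fine (P (N k)).
have PNE : P (N k) = a%:E by rewrite fineK// fin_num_measure.
have a0 : 0 < a.
  by rewrite -lte_fin -PNE lt0e PN0 measure_ge0.
(* The factor [a^(2/p)], with [a] the probability of [N k], turns pointwise bounds on [Z i l] into
   bounds on integrals over [N k]; the value 1 past [n] keeps [b] positive. *)
pose b i := (if (i <= n)%N then r k i else 1) * a `^ (2 / p).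
have ap0 : 0 < a `^ (2 / p) by rewrite powR_gt0.
have b_gt0 i : 0 < b i by rewrite mulr_gt0//; case: ifP => // ni; exact: r0.
have bE i : (i <= n)%N -> b i `^ (p / 2) = r k i `^ (p / 2) * a.
  move=> ni; rewrite /b ni powRM ?(ltW (r0 _ _)) ?(ltW ap0)// -powRrM.
  rewrite (_ : 2 / p * (p / 2) = 1) ?powRr1 ?(ltW a0)//.
  by field; rewrite gt_eqF.
have icst (x : R) : P.-integrable (N k) (EFin \o cst x).
  exact: finite_measure_integrable_cst.
have XY_le i l : (1 <= i)%N -> (i <= l <= n)%N ->
  \int[P]_(w in N k)
    (`|X i w| `^ (p / 2) * `|\sum_(i <= j < l.+1) Y i j w| `^ (p / 2))
  <= b i `^ (p / 2).
  move=> i1 /[dup] iln /andP[il ln]; have [_ _ iZ ZE] := ceZ i l i1 iln.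
  (* As [N k] is in [F 0], the product may be replaced under the integral by [Z i l], which is below
     [r k i^(p/2)] there. *)
  rewrite bE ?(leq_trans il)// /Rintegral -ZE//.
  rewrite -[leRHS](_ : \int[P]_(w in N k) (cst (r k i `^ (p / 2)) w) = _); last first.
    by rewrite Rintegral_cst.
  apply: le_Rintegral => //; first exact: integrableS iZ.
  by move=> x [_ /(_ i l i1 iln)/ltW].
have iXY i l : (1 <= i)%N -> (i <= l <= n)%N -> P.-integrable setT (fun w =>
    (`|X i w| `^ (p / 2) * `|\sum_(i <= j < l.+1) Y i j w| `^ (p / 2))%:E).
  by move=> i1 il; have [] := ceZ i l i1 il.
have := moment_bound p2 K0 CE sB psi_D2 D2_le filtF mX iX ceY iXY FN b_gt0
  (b_gt0 0%N) XY_le.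
(* Here [eta] is [b 0], which joins the sum as its term of index 0. *)
have -> : b 0%N + \sum_(1 <= i < n.+1) b i =
    (\sum_(0 <= i < n.+1) r k i) * a `^ (2 / p).
  rewrite -big_ltn// mulr_suml big_nat [RHS]big_nat.
  by apply: eq_bigr => i /= ni; rewrite /b -ltnS ni.
have sr0 : 0 <= \sum_(0 <= i < n.+1) r k i.
  by rewrite big_nat sumr_ge0// => i /= ni; exact/ltW/r0.
rewrite powRM ?(ltW ap0)// -powRrM (_ : 2 / p * (p / 2) = 1); last first.
  by field; rewrite gt_eqF.
(* The bound is now [kappa k * a], and [W] has the same integral over [N k] as the power of the
   norm. Its mean there is at most [kappa k], although it exceeds [kappa k] at every point. *)
rewrite powRr1 ?(ltW a0)// mulrA -/(kappa k) /Rintegral -WE// -/(Rintegral _ _ _) => leW.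
have iWN : P.-integrable (N k) (EFin \o W) by exact: integrableS iW.
apply/negligibleP => //.
apply: (@Rintegral_le0_null _ _ _ P (N k) (fun x => W x - kappa k)) => //.
- exact: (integrableB mN iWN (icst (kappa k))).
- by move=> x [kW _]; rewrite subr_gt0.
by rewrite RintegralB//; [rewrite Rintegral_cst// subr_le0|exact: icst].
Qed.
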